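(* Let $n\ge 2$ be an integer. For all $\tau\in\mathbb{C}$, $Q_{n,n-1}(E,\tau)=\mathbb{C}[x_0,\ldots,x_{n-1}]$, the polynomial ring on the $n$ variables $x_0,\ldots,x_{n-1}$.
   Context: Notation: $e(z)=e^{2\pi i z}$; $\mathbb{Z}_n=\mathbb{Z}/n\mathbb{Z}$. Fix $\eta\in\mathbb{C}$ in the upper half-plane, $\Lambda=\mathbb{Z}+\mathbb{Z}\eta$, $E=\mathbb{C}/\Lambda$, and $E[n]=\frac1n\Lambda/\Lambda$. Let $\theta(z)=\sum_{m\in\mathbb{Z}}(-1)^m e\big(mz+\tfrac12 m(m-1)\eta\big)$ and, for $\alpha\in\mathbb{Z}$, $$\theta_\alpha(z)=e\Big(\alpha z+\tfrac{\alpha}{2n}+\tfrac{\alpha(\alpha-n)}{2n}\eta\Big)\prod_{m=0}^{n-1}\theta\Big(z+\tfrac mn+\tfrac{\alpha}{n}\eta\Big),$$ which depends only on $\alpha$ modulo $n$; the zeros of the $\theta_\alpha$'s lie in $\frac1n\Lambda$. Let $n>k\ge1$ be relatively prime integers, $V$ a $\mathbb{C}$-vector space with basis $\{x_i\mid i\in\mathbb{Z}_n\}$ and $TV=\mathbb{C}\langle x_0,\ldots,x_{n-1}\rangle$ its tensor algebra. For $\tau\in\mathbb{C}-\frac1n\Lambda$ and $i,j\in\mathbb{Z}_n$ let $$r_{ij}(\tau)=\sum_{r\in\mathbb{Z}_n}\frac{\theta_{j-i+(k-1)r}(0)}{\theta_{j-i-r}(-\tau)\,\theta_{kr}(\tau)}\;x_{j-r}\otimes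 x_{i+r}\in V\otimes V.$$ Up to a non-zero scalar, $r_{ij}(\tau)$ depends only on $\tau+\Lambda$. If $r_{ij}$ is not identically zero on $\mathbb{C}-\frac1n\Lambda$, then it is nowhere zero there, and $\tau\mapsto L_{ij}(\tau):=\mathbb{C}\cdot r_{ij}(\tau)$ is a morphism $E-E[n]\to\mathbb{P}(V\otimes V)$ (the projective space of $1$-dimensional subspaces) that extends uniquely to a morphism $L_{ij}:E\to\mathbb{P}(V\otimes V)$; for $\tau\in\mathbb{C}$, $L_{ij}(\tau)\subseteq V\otimes V$ denotes the line that is the image of $\tau+\Lambda$. For all $\tau\in\mathbb{C}$, $\mathrm{rel}_{n,k}(E,\tau)\subseteq V\otimes V$ is the linear span of these $L_{ij}(\tau)$'s (over all $(i,j)$ with $r_{ij}$ not identically zero), and $Q_{n,k}(E,\tau)=TV/(\mathrm{rel}_{n,k}(E,\tau))$. Equality of algebras presented on the generators $x_i$ means equality as quotients of $TV$. *)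

(* Defs.v *)
From HB Require Import structures.
From mathcomp Require Import all_boot all_order all_algebra.
From mathcomp Require Import all_classical all_reals all_analysis.
From mathcomp Require Import complex.
(* Some notations clash with those of MathComp-Analysis. *)
From mathcomp Require monalg mpoly.
Import -(notations) monalg mpoly.

Set Implicit Arguments.
Unset Strict Implicit.
Unset Printing Implicit Defensive.

Import Order.TTheory GRing.Theory Num.Theory.
Import numFieldNormedType.Exports.

Local Open Scope classical_set_scope.
Local Open Scope ring_scope.
Local Open Scope complex_scope.

(* The usual topology on [R[i]], as a normed space over itself: [derivable]
   is then complex differentiability. *)
HB.instance Definition _ (R : realType) :=
  PseudoPointedMetric.copy R[i] R[i]^o.
HB.instance Definition _ (R : realType) := NormedModule.copy R[i] R[i]^o.

Section Theta.
Variable R : realType.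
Local Notation C := R[i].

Definition cexp (z : C) : C :=
  (expR (complex.Re z))%:C * (cos (complex.Im z) +i* sin (complex.Im z)).

Definition e (z : C) : C := cexp ((0 +i* (2 * pi)) * z).

(* Sum over all integers as two one-sided series ([Negz m] is [- m.+1]). *)
Definition zsum (a : int -> C) : C :=
  limn (series (fun m => a (Posz m))) + limn (series (fun m => a (Negz m))).

Definition lattice (eta : C) : set C :=
  [set z | exists a b : int, z = a%:~R + b%:~R * eta].

(* (1/n) Lambda, the inverse image in C of the n-torsion of E = C / Lambda. *)
Definition torsion_lattice (n : nat) (eta : C) : set C :=
  [set z | lattice eta (n%:R * z)].

Definition theta (eta z : C) : C :=
  zsum (fun m => (-1) ^ m * e (m%:~R * z + (m * (m - 1))%:~R / 2 * eta)).

Definition theta_ (n : nat) (eta : C) (alpha : int) (z : C) : C :=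
  e (alpha%:~R * z + alpha%:~R / (2 * n%:R)
     + (alpha * (alpha - n%:Z))%:~R / (2 * n%:R) * eta)
  * \prod_(m < n) theta eta (z + m%:R / n%:R + alpha%:~R / n%:R * eta).

End Theta.

(* V (x) V in coordinates: the basis tensor x_a (x) x_b is [delta_mx a b]. The
   index type ['Z_n] is Z / nZ only for 1 < n. *)
Notation tensor2 R n := 'M[R[i]]_((Zp_trunc n).+2).

(* The tensor algebra TV = C<x_0, ..., x_(n-1)>, as the algebra over C of the
   free monoid on ['Z_n]. *)
Notation tensor_algebra R n := (monalg.malg (monalg.fmonom 'Z_n) R[i]).

Section Relations.
Variables (R : realType) (n k : nat) (eta : R[i]).
Local Notation C := R[i].
Local Notation VV := (tensor2 R n).

(* Subscripts of [theta_] are computed on the representatives 0 <= i < n of the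
   elements of ['Z_n]; [theta_ n eta alpha] depends only on alpha modulo n. *)
Definition r_ (i j : 'Z_n) (tau : C) : VV :=
  \sum_(r : 'Z_n)
    (theta_ n eta (j%:Z - i%:Z + (k%:Z - 1) * r%:Z) 0
     / (theta_ n eta (j%:Z - i%:Z - r%:Z) (- tau)
        * theta_ n eta (k%:Z * r%:Z) tau))
    *: delta_mx (j - r) (i + r).

(* Morphisms from E = C / Lambda to P(V (x) V), as Lambda-periodic maps from C
   to lines that have, locally, a holomorphic nowhere zero generator. *)
Definition morphism_to_lines (L : C -> {vspace VV}) : Prop :=
  (forall z l : C, lattice eta l -> L (z + l) = L z) /\
  (forall z0 : C, exists f : C -> VV, \forall z \near z0,
     [/\ f z != 0, L z = <[f z]>%VS
       & forall a b, derivable (fun w => f w a b) z 1]).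

Definition extends_r (i j : 'Z_n) (L : C -> {vspace VV}) : Prop :=
  forall tau, ~ torsion_lattice n eta tau -> L tau = <[r_ i j tau]>%VS.

Definition r_nonzero (i j : 'Z_n) : Prop :=
  exists2 tau, ~ torsion_lattice n eta tau & r_ i j tau != 0.

(* The morphism that extends [tau |-> C . r_ i j tau]; it exists and is unique
   when [r_nonzero i j], and only this case is used. *)
Definition L_ (i j : 'Z_n) : C -> {vspace VV} :=
  xget (fun=> 0%VS) [set L | morphism_to_lines L /\ extends_r i j L].

Definition rel_nk (tau : C) : {vspace VV} :=
  (\sum_(ij : 'Z_n * 'Z_n | `[< r_nonzero ij.1 ij.2 >]) L_ ij.1 ij.2 tau)%VS.

End Relations.

Section Algebras.

Definition two_sided_ideal (A : nzRingType) (I : set A) : Prop :=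
  [/\ I 0, forall a b, I a -> I b -> I (a + b)
    & forall a b c, I b -> I (a * b * c)].

Definition ideal_generated (A : nzRingType) (S : set A) : set A :=
  [set a | forall I, two_sided_ideal I -> S `<=` I -> I a].

(* [B], with the projection [p], is the quotient algebra A / I. *)
Definition is_quotient_by (K : nzRingType) (A B : lalgType K)
    (I : set A) (p : A -> B) : Prop :=
  [/\ linear p, monoid_morphism p, forall b, exists a, p a = b
    & forall a, p a = 0 <-> I a].

Variables (R : realType) (n : nat).
Local Notation C := R[i].
Local Notation TV := (tensor_algebra R n).

Definition gen (i : 'Z_n) : TV := monalg.mkmalgU (monalg.fmu i) 1.

Definition tensor2_in_TV (t : tensor2 R n) : TV :=
  \sum_(a : 'Z_n) \sum_(b : 'Z_n) t a b *: (gen a * gen b).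

(* The kernel of TV -> Q_(n,k)(E, tau). *)
Definition Q_ideal (k : nat) (eta tau : C) : set TV :=
  ideal_generated (tensor2_in_TV @` [set t | t \in rel_nk n k eta tau]).

(* The algebra morphism from TV to the polynomial ring with x_i |-> 'X_i;
   the cast identifies ['Z_n] with ['I_n]. *)
Definition TV_to_poly (n_gt1 : (1 < n)%N) : TV -> mpoly.mpoly n C :=
  monalg.mmap (@mpoly.mpolyC n C)
    (fun w => \prod_(i <- monalg.fmonom_val w)
       mpoly.mpolyX C (mpoly.mnm1 (cast_ord (Zp_cast n_gt1) i))).

End Algebras.

Arguments Q_ideal {R} n k eta tau _.
Arguments TV_to_poly R {n} n_gt1 _.

(* Main.v *)
Require Import Defs.
From HB Require Import structures.
From mathcomp Require Import all_boot all_order all_algebra.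
From mathcomp Require Import all_classical all_reals all_analysis.
From mathcomp Require Import complex ring lra zify.
From mathcomp Require monalg mpoly.
Import -(notations) monalg mpoly.

(** The relations at [tau] span exactly the antisymmetric tensors, whatever
    [tau] is ([rel_nkE]). The ideal that they generate is then generated by the
    commutators of the [x_i], and the quotient is the polynomial ring: modulo
    commutators a word only depends on its exponent ([ideal_ker]).

    For [k = n - 1] the coefficient of [x_a (x) x_b] in [r_ij (tau)] is zero
    unless [a + b = i + j], and otherwise it is
    [kappa a b / (theta_(a-j) (tau) theta_(b-j) (tau))] up to a factor that
    depends on [j] and [tau] only ([r_entry]). Here [kappa] is antisymmetric and
    vanishes on the diagonal only. Multiplying by suitable [theta_al (tau)]
    clears the denominators and leaves an entire function [cleared_r] of [tau]
    with values in the antisymmetric tensors. If [r_ij] is not identically zero,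
    [cleared_r] has no zero, so that it generates the line [L_ij (tau)] at every
    [tau], torsion points included ([L_E]). Hence all relations are
    antisymmetric.

    Conversely, each wedge [x_a (x) x_b - x_b (x) x_a] is a relation.
    - If [tau] is a torsion point, [theta_al (tau) = 0] for exactly one index
      [al]. For a suitable [j] this kills all coefficients of [cleared_r] but
      those of [x_a (x) x_b] and [x_b (x) x_a] ([wedge_torsion]).
    - Otherwise, fix the weight [m = i + j]. The product
      [theta_(a-j) (tau) theta_(m-a-j) (tau)] is, up to factors of [j] alone and
      of [a] alone, a determinant [p_j.1 * q_a.2 - p_j.2 * q_a.1]: this is the
      three-term identity for [theta] ([theta_three_term], [theta_level_pair]).
      The coefficients of the relations thus form a Cauchy matrix, and Gaussian
      elimination isolates each wedge ([cauchy_span], [wedge_nontorsion]).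

    The analytic facts about [theta] are its quasi-periodicity, its zeros, and
    the formula [theta_multiplication], by which [theta_alpha (z)] is a
    non-vanishing factor times the theta function for [n eta] at
    [n z + alpha eta]. The last two come from the Jacobi triple product, which is
    the limit of the finite q-binomial theorem. The series are handled as
    unordered sums over the integers, so that they can be reindexed and
    multiplied freely, and limits are exchanged with sums by dominated
    convergence. *)

Set Implicit Arguments.
Unset Strict Implicit.
Unset Printing Implicit Defensive.

Import Order.TTheory GRing.Theory Num.Theory.
Import numFieldNormedType.Exports.

Local Open Scope classical_set_scope.
Local Open Scope ring_scope.
Local Open Scope complex_scope.

(** * Unordered summation over the complex numbers *)

Section Modulus.
Variable R : realType.
Local Notation C := R[i].
Implicit Types z w : C.

Lemma normcE z : `|z| = (Normc.normc z)%:C. Proof. by []. Qed.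

Lemma normc_ge0 z : 0 <= Normc.normc z.
Proof. by have := normr_ge0 z; rewrite normcE ler0c. Qed.

Lemma normc_triangle z w :
  Normc.normc (z + w) <= Normc.normc z + Normc.normc w.
Proof. exact: le_normcD. Qed.

Lemma normc_opp z : Normc.normc (- z) = Normc.normc z.
Proof. exact: normcN. Qed.

Lemma normc_distC z w : Normc.normc (z - w) = Normc.normc (w - z).
Proof. by rewrite -normc_opp opprB. Qed.

Lemma normcMl z w : Normc.normc (z * w) = Normc.normc z * Normc.normc w.
Proof. exact: Normc.normcM. Qed.

Lemma normc_eq0 z : (Normc.normc z == 0) = (z == 0).
Proof. by apply/eqP/eqP => [/Normc.eq0_normc|->]; rewrite ?Normc.normc0. Qed.

Lemma normc_gt0 z : (0 < Normc.normc z) = (z != 0).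
Proof. by rewrite lt_def normc_ge0 andbT normc_eq0. Qed.

Lemma normcX z n : Normc.normc (z ^+ n) = Normc.normc z ^+ n.
Proof.
by elim: n => [|n IH]; rewrite ?expr0 ?Normc.normc1// !exprS normcMl IH.
Qed.

Lemma normc_real (x : R) : Normc.normc x%:C = `|x|.
Proof. by rewrite /Normc.normc /= expr0n /= addr0 sqrtr_sqr. Qed.

Lemma normc_sum (I : Type) (s : seq I) (P : pred I) (f : I -> C) :
  Normc.normc (\sum_(i <- s | P i) f i)
    <= \sum_(i <- s | P i) Normc.normc (f i).
Proof.
elim/big_ind2: _ => [|z x w y zx wy|//]; first by rewrite Normc.normc0.
exact: le_trans (normc_triangle _ _) (lerD zx wy).
Qed.

Lemma normc_prod (I : Type) (s : seq I) (P : pred I) (f : I -> C) :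
  Normc.normc (\prod_(i <- s | P i) f i)
    = \prod_(i <- s | P i) Normc.normc (f i).
Proof. by apply: (big_morph _ normcMl); exact: Normc.normc1. Qed.

Lemma normc_Re z : `|complex.Re z| <= Normc.normc z.
Proof. by rewrite -lecR; exact: normc_ge_Re. Qed.

Lemma normc_Im z : `|complex.Im z| <= Normc.normc z.
Proof.
have := normc_Re (z * 'i%C); rewrite ReiNIm normrN normcMl.
by rewrite /Normc.normc /= !expr0n /= add0r expr1n sqrtr1 mulr1.
Qed.

Lemma cvg_normcP (T : Type) (F : set_system T) (f : T -> C) (l : C) :
  Filter F ->
  (f x @[x --> F] --> l) <->
  (forall eps : R, 0 < eps -> \forall x \near F, Normc.normc (f x - l) < eps).
Proof.
move=> FF; split => [/cvgrPdist_lt cf eps eps0|cf].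
  have := cf eps%:C; rewrite ltcR => /(_ eps0); apply: filterS => x.
  by rewrite distrC normcE ltcR.
apply/cvgrPdist_lt => eps eps0.
have epsE : eps = (complex.Re eps)%:C.
  by case: eps eps0 => a b; rewrite ltcE /= => /andP[/eqP -> _].
rewrite epsE ltcR in eps0 *.
apply: filterS (cf _ eps0) => x.
by rewrite distrC normcE epsE ltcR.
Qed.

Lemma cvg_normc_lt (T : Type) (F : set_system T) (FF : Filter F)
    (f : T -> C) (l : C) : f x @[x --> F] --> l ->
  forall eps : R, 0 < eps -> \forall x \near F, Normc.normc (f x - l) < eps.
Proof. by move/cvg_normcP. Qed.

End Modulus.

Section UnorderedSum.
Variable R : realType.
Local Notation C := R[i].
Local Notation nm := (@Normc.normc R).

(** Unconditional convergence: [S] is the limit of the finite partial sums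
    along the directed set of finite sets of indices, each listed by a
    duplicate-free sequence. *)
Definition has_sum (I : eqType) (f : I -> C) (S : C) :=
  forall eps : R, 0 < eps -> exists s0 : seq I, forall s,
    uniq s -> {subset s0 <= s} -> nm (\sum_(i <- s) f i - S) < eps.

Definition dominated_sum (I : eqType) (g : I -> R) :=
  exists B : R, forall s, uniq s -> \sum_(i <- s) g i <= B.

Definition abs_summable (I : eqType) (f : I -> C) :=
  dominated_sum (fun i => nm (f i)).

Lemma big_subset_split (V : zmodType) (I : eqType) (s0 s : seq I)
    (f : I -> V) : uniq s0 -> uniq s -> {subset s0 <= s} ->
  \sum_(i <- s) f i
    = \sum_(i <- s0) f i + \sum_(i <- s | i \notin s0) f i.
Proof.
move=> u0 us sub; rewrite (bigID (mem s0)) /=; congr (_ + _).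
rewrite -big_filter; apply: perm_big; apply: uniq_perm => //.
  exact: filter_uniq.
by move=> i; rewrite mem_filter; case: (boolP (i \in s0)) => //= /sub ->.
Qed.

Lemma has_sum_uniq (I : eqType) (f : I -> C) S T :
  has_sum f S -> has_sum f T -> S = T.
Proof.
move=> fS fT; apply/eqP; rewrite -subr_eq0 -normc_eq0 eq_le normc_ge0 andbT.
rewrite leNgt; apply/negP => d0.
have d2 : 0 < nm (S - T) / 2 by rewrite divr_gt0.
have [s hs] := fS _ d2; have [t ht] := fT _ d2.
have := hs (undup (s ++ t)); have := ht (undup (s ++ t)).
rewrite undup_uniq => /(_ isT) h1 /(_ isT) h2.
have {}h1 := h1 _; have {}h2 := h2 _.
have {}h1 : nm (\sum_(i <- undup (s ++ t)) f i - T) < nm (S - T) / 2.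
  by apply: h1 => i; rewrite mem_undup mem_cat => ->; rewrite orbT.
have {}h2 : nm (\sum_(i <- undup (s ++ t)) f i - S) < nm (S - T) / 2.
  by apply: h2 => i; rewrite mem_undup mem_cat => ->.
set X := \sum_(i <- _) _ in h1 h2.
have := normc_triangle (S - X) (X - T).
rewrite addrA subrK (normc_distC S X); move: h1 h2.
by move: (nm (S - T)) (nm (X - S)) (nm (X - T)) => x y z; lra.
Qed.

Lemma has_sumD (I : eqType) (f g : I -> C) S T :
  has_sum f S -> has_sum g T -> has_sum (fun i => f i + g i) (S + T).
Proof.
move=> fS gT eps e0.
have e2 : 0 < eps / 2 by rewrite divr_gt0.
have [s hs] := fS _ e2; have [t ht] := gT _ e2.
exists (s ++ t) => r ur str.
have h1 := hs r ur _; have h2 := ht r ur _.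
have {}h1 : nm (\sum_(i <- r) f i - S) < eps / 2.
  by apply: h1 => i si; apply: str; rewrite mem_cat si.
have {}h2 : nm (\sum_(i <- r) g i - T) < eps / 2.
  by apply: h2 => i si; apply: str; rewrite mem_cat si orbT.
rewrite big_split /= opprD addrACA.
by apply: le_lt_trans (normc_triangle _ _) _; rewrite [ltRHS]splitr ltrD.
Qed.

Lemma has_sumZ (I : eqType) (f : I -> C) S c :
  has_sum f S -> has_sum (fun i => c * f i) (c * S).
Proof.
move=> fS eps e0.
have c1 : 0 < nm c + 1 by have := normc_ge0 c; lra.
have [s hs] := fS _ (divr_gt0 e0 c1).
exists s => r ur sr; rewrite -mulr_sumr -mulrBr normcMl.
have := hs r ur sr; rewrite ltr_pdivlMr //.
move: (normc_ge0 (\sum_(i <- r) f i - S)) (normc_ge0 c).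
by move: (nm (_ - _)) (nm c) => x y; nra.
Qed.

Lemma eq_has_sum (I : eqType) (f g : I -> C) S :
  f =1 g -> has_sum f S -> has_sum g S.
Proof.
move=> fg fS eps /fS[s hs]; exists s => r ur sr.
by rewrite -(eq_bigr _ (fun i _ => fg i)); exact: hs.
Qed.

Lemma dominated_sum_le (I : eqType) (f g : I -> R) :
  (forall i, f i <= g i) -> dominated_sum g -> dominated_sum f.
Proof.
move=> fg [B hB]; exists B => s us; apply: le_trans (hB s us).
exact: ler_sum.
Qed.

Lemma dominated_sumD (I : eqType) (f g : I -> R) :
  dominated_sum f -> dominated_sum g -> dominated_sum (fun i => f i + g i).
Proof.
move=> [A hA] [B hB]; exists (A + B) => s us.
by rewrite big_split lerD ?hA ?hB.
Qed.

Lemma dominated_sumZ (I : eqType) (c : R) (f : I -> R) : 0 <= c ->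
  dominated_sum f -> dominated_sum (fun i => c * f i).
Proof.
move=> c0 [A hA]; exists (c * A) => s us.
by rewrite -mulr_sumr ler_wpM2l ?hA.
Qed.

(** Bounded nonnegative sums converge to their least upper bound. *)
Lemma has_sum_nonneg (I : eqType) (g : I -> R) :
  (forall i, 0 <= g i) -> dominated_sum g ->
  exists S : R, has_sum (fun i => (g i)%:C) S%:C.
Proof.
move=> g0 [B hB].
pose E := [set x | exists2 s, uniq s & x = \sum_(i <- s) g i].
have supE : has_sup E.
  split; first by exists 0; exists [::]; rewrite ?big_nil.
  by exists B => x [s us ->]; exact: hB.
exists (sup E) => eps e0.
have [x [s us ->] hs] := sup_adherent e0 supE.
exists s => r ur sr; rewrite -rmorph_sum -rmorphB normc_real.
have rE : \sum_(i <- r) g i <= sup E.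
  by apply: sup_upper_bound => //; exists r.
have sle : \sum_(i <- s) g i <= \sum_(i <- r) g i.
  by rewrite (big_subset_split _ us ur sr) lerDl sumr_ge0.
by rewrite ltr_norml; apply/andP; split; move: hs rE sle e0; lra.
Qed.

(** Each of the real and imaginary parts [h] is the difference of the bounded
    nonnegative sums of [h + |h|] and of [|h|]. *)
Lemma abs_summable_has_sum (I : eqType) (f : I -> C) :
  abs_summable f -> exists S, has_sum f S.
Proof.
move=> sf.
have part (h : I -> R) : (forall i, `|h i| <= nm (f i)) ->
    exists S, has_sum (fun i => (h i)%:C) S.
  move=> hf.
  have sh : dominated_sum (fun i => `|h i|) by exact: dominated_sum_le sf.
  have [A hA] := has_sum_nonneg (fun i => normr_ge0 (h i)) sh.
  have [i||B hB] := @has_sum_nonneg I (fun i => h i + `|h i|).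
  - by have := ler_norm (- h i); rewrite normrN; lra.
  - apply: dominated_sum_le (dominated_sumD sh sh) => i.
    by rewrite lerD2r ler_norm.
  exists (B%:C + (-1) * A%:C).
  apply: eq_has_sum (has_sumD hB (has_sumZ (-1) hA)) => i /=.
  by rewrite rmorphD mulN1r addrK.
have [A hA] := part _ (fun i => normc_Re (f i)).
have [B hB] := part _ (fun i => normc_Im (f i)).
exists (A + 'i%C * B).
apply: eq_has_sum (has_sumD hA (has_sumZ 'i%C hB)) => i.
by rewrite -complexE.
Qed.

Lemma dominated_sum_tail (I : eqType) (g : I -> R) (eps : R) :
  (forall i, 0 <= g i) -> dominated_sum g -> 0 < eps ->
  exists2 s0, uniq s0 &
    forall s, uniq s -> {subset s0 <= s} ->
      \sum_(i <- s | i \notin s0) g i < eps.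
Proof.
move=> g0 sg e0; have [S hS] := has_sum_nonneg g0 sg.
have e2 : 0 < eps / 2 by rewrite divr_gt0.
have [s0 hs0] := hS _ e2.
exists (undup s0); first exact: undup_uniq.
move=> s us sub.
have h1 : nm (\sum_(i <- s) (g i)%:C - S%:C) < eps / 2.
  by apply: hs0 => // i; rewrite -mem_undup; exact: sub.
have h0 : nm (\sum_(i <- undup s0) (g i)%:C - S%:C) < eps / 2.
  by apply: hs0; rewrite ?undup_uniq// => i; rewrite mem_undup.
move: h0 h1; rewrite -!rmorph_sum -!rmorphB !normc_real.
rewrite (big_subset_split _ (undup_uniq s0) us sub) !ltr_norml.
by move=> /andP[? ?] /andP[? ?]; lra.
Qed.

(** A bound that does not depend on the terms of [f], only on their common
    majorant: this uniformity is what makes Tannery's theorem work. *)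
Lemma has_sum_dist (I : eqType) (f : I -> C) (g : I -> R) S s0 (eps : R) :
  has_sum f S -> (forall i, nm (f i) <= g i) -> uniq s0 ->
  (forall s, uniq s -> {subset s0 <= s} ->
     \sum_(i <- s | i \notin s0) g i < eps) ->
  nm (\sum_(i <- s0) f i - S) <= eps.
Proof.
move=> fS fg u0 tail; apply/ler_addgt0Pr => d d0.
have [s1 hs1] := fS _ d0; pose s := undup (s0 ++ s1).
have us : uniq s by exact: undup_uniq.
have sub0 : {subset s0 <= s}.
  by move=> i si; rewrite mem_undup mem_cat si.
have h1 : nm (\sum_(i <- s) f i - S) < d.
  by apply: hs1 => // i si; rewrite mem_undup mem_cat si orbT.
have h2 : nm (\sum_(i <- s | i \notin s0) f i) < eps.
  by apply: le_lt_trans (tail s us sub0); apply: le_trans (normc_sum _ _ _) _;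
    apply: ler_sum.
move: h1; rewrite (big_subset_split _ u0 us sub0) => h1.
set a := \sum_(i <- s0) f i in h1 *; set b := \sum_(i <- s | _) f i in h1 h2.
have := normc_triangle (a + b - S) (- b).
rewrite normc_opp addrAC addrK; move: h1 h2.
by move: (nm (_ + _)) (nm b) (nm (_ - _)) => x y z; lra.
Qed.

(** Tannery's theorem: dominated convergence for series. *)
Lemma dominated_has_sum_cvg (I : eqType) (T : Type) (F : set_system T)
    (f : T -> I -> C) (l : I -> C) (g : I -> R) (S : T -> C) (L : C) :
  ProperFilter F ->
  (forall i, 0 <= g i) -> dominated_sum g ->
  (\forall x \near F, has_sum (f x) (S x) /\ forall i, nm (f x i) <= g i) ->
  (forall i, nm (l i) <= g i) -> has_sum l L ->
  (forall i, f x i @[x --> F] --> l i) ->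
  S x @[x --> F] --> L.
Proof.
move=> FF g0 sg nearf lg lL fl; apply/cvg_normcP => eps e0.
have e4 : 0 < eps / 4 by rewrite divr_gt0.
have [s0 u0 tail] := dominated_sum_tail g0 sg e4.
have lim0 : \sum_(i <- s0) f x i @[x --> F] --> \sum_(i <- s0) l i.
  elim: (s0) => [|i s IH].
    by rewrite big_nil; under eq_fun do rewrite big_nil; exact: cvg_cst.
  rewrite big_cons; under eq_fun do rewrite big_cons.
  exact: (cvgD (fl i) IH).
move/cvg_normcP : lim0 => /(_ _ e4) lim0.
apply: filterS2 lim0 nearf => x h0 [fS fg].
have h1 := has_sum_dist fS fg u0 tail.
have h2 := has_sum_dist lL lg u0 tail.
set a := \sum_(i <- s0) f x i in h0 h1; set b := \sum_(i <- s0) l i in h0 h2.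
have h3 := normc_triangle (S x - a) (a - b + (b - L)).
have h4 := normc_triangle (a - b) (b - L).
have -> : S x - L = S x - a + (a - b + (b - L)).
  by rewrite !addrA !subrK.
move: h0 h1 h2 h3 h4; rewrite (normc_distC (S x) a).
move: (nm (S x - a + _)) (nm (a - b + _)) (nm (a - S x)) => ? ? ?.
by move: (nm (a - b)) (nm (b - L)) => ? ?; lra.
Qed.

Lemma has_sum_reindex (I J : eqType) (h : J -> I) (f : I -> C) S :
  bijective h -> has_sum f S -> has_sum (f \o h) S.
Proof.
move=> [k hk kh] fS eps /fS[s0 hs0]; exists (map k s0) => s us sub.
rewrite -(big_map h xpredT f); apply: hs0.
  by rewrite map_inj_uniq //; exact: can_inj hk.
move=> i is0; apply/mapP; exists (k i); last by rewrite kh.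
by apply: sub; exact: map_f.
Qed.

Lemma dominated_sum_inj (I J : eqType) (h : J -> I) (g : I -> R) :
  injective h -> dominated_sum g -> dominated_sum (g \o h).
Proof.
move=> hi [B hB]; exists B => s us; rewrite -(big_map h xpredT g).
by apply: hB; rewrite map_inj_uniq.
Qed.

Lemma sum_by_summands (V : zmodType) (I J : eqType) (s : seq (I + J))
    (f : I + J -> V) :
  exists s1 s2, [/\ perm_eq s (map inl s1 ++ map inr s2),
    (uniq s -> uniq s1 && uniq s2),
    s1 =i [pred i | inl i \in s] & s2 =i [pred j | inr j \in s]].
Proof.
exists (pmap (fun x => if x is inl i then Some i else None) s).
exists (pmap (fun x => if x is inr i then Some i else None) s).
split.
- elim: s => //= -[i|j] s IH /=; rewrite ?perm_cons //.
  by rewrite perm_sym -cat_rcons -cats1 -catA perm_catCA /= perm_cons perm_sym.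
- move=> us; apply/andP; split.
  + by apply: (pmap_uniq (g := inl)) us => -[].
  + by apply: (pmap_uniq (g := inr)) us => -[].
- move=> i; rewrite inE mem_pmap; apply/mapP/idP => [[[] //= j js [->]] //|].
  by exists (inl i).
- move=> i; rewrite inE mem_pmap; apply/mapP/idP => [[[] //= j js [->]] //|].
  by exists (inr i).
Qed.

Lemma has_sum_sum (I J : eqType) (f : I + J -> C) S T :
  has_sum (f \o inl) S -> has_sum (f \o inr) T -> has_sum f (S + T).
Proof.
move=> fS fT eps e0.
have e2 : 0 < eps / 2 by rewrite divr_gt0.
have [s hs] := fS _ e2; have [t ht] := fT _ e2.
exists (map inl s ++ map inr t) => r ur sub.
have [s1 [s2 [pe /(_ ur)/andP[u1 u2] m1 m2]]] := sum_by_summands r f.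
rewrite (perm_big _ pe) big_cat !big_map opprD addrACA.
have h1 : nm (\sum_(i <- s1) f (inl i) - S) < eps / 2.
  apply: hs => // i si; rewrite m1 inE; apply: sub.
  by rewrite mem_cat map_f.
have h2 : nm (\sum_(i <- s2) f (inr i) - T) < eps / 2.
  apply: ht => // i si; rewrite m2 inE; apply: sub.
  by rewrite mem_cat [X in _ || X]map_f ?orbT.
by apply: le_lt_trans (normc_triangle _ _) _; rewrite [ltRHS]splitr ltrD.
Qed.

Lemma dominated_sum_sum (I J : eqType) (g : I + J -> R) :
  dominated_sum (g \o inl) -> dominated_sum (g \o inr) -> dominated_sum g.
Proof.
move=> [A hA] [B hB]; exists (A + B) => r ur.
have [s1 [s2 [pe /(_ ur)/andP[u1 u2] _ _]]] := sum_by_summands r g.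
by rewrite (perm_big _ pe) big_cat !big_map lerD //; [exact: hA|exact: hB].
Qed.

Lemma dominated_sum_prod (I J : eqType) (f : I -> R) (g : J -> R) :
  (forall i, 0 <= f i) -> (forall j, 0 <= g j) ->
  dominated_sum f -> dominated_sum g ->
  dominated_sum (fun p : I * J => f p.1 * g p.2).
Proof.
move=> f0 g0 [A hA] [B hB]; exists (A * B) => s us.
pose s1 := undup (map fst s); pose s2 := undup (map snd s).
have sub : {subset s <= [seq (i, j) | i <- s1, j <- s2]}.
  move=> -[i j] ijs; apply/allpairsP; exists (i, j).
  by rewrite !mem_undup (map_f fst ijs) (map_f snd ijs).
have ub : uniq [seq (i, j) | i <- s1, j <- s2].
  by apply: allpairs_uniq; rewrite ?undup_uniq // => -[a b] [c d] _ _ [-> ->].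
apply: (@le_trans _ _ (\sum_(p <- [seq (i, j) | i <- s1, j <- s2])
    f p.1 * g p.2)).
  rewrite (big_subset_split _ us ub sub) lerDl.
  by apply: sumr_ge0 => p _; exact: mulr_ge0.
rewrite big_allpairs_dep /=; under eq_bigr do rewrite -mulr_sumr.
rewrite -mulr_suml ler_pM ?sumr_ge0 //; first by rewrite hA ?undup_uniq.
by rewrite hB ?undup_uniq.
Qed.

(** The product family is absolutely summable, so that it has some sum, and the
    partial sums over rectangles tend to the product of the two sums. *)
Lemma has_sum_prod (I J : eqType) (f : I -> C) (g : J -> C) S T :
  abs_summable f -> abs_summable g -> has_sum f S -> has_sum g T ->
  has_sum (fun p : I * J => f p.1 * g p.2) (S * T).
Proof.
move=> sf sg fS gT.
have sfg : abs_summable (fun p : I * J => f p.1 * g p.2).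
  rewrite /abs_summable; under eq_fun do rewrite normcMl.
  by apply: (dominated_sum_prod (f := nm \o f) (g := nm \o g)) => // ?;
    exact: normc_ge0.
have [U hU] := abs_summable_has_sum sfg.
suff -> : S * T = U by [].
apply/eqP; rewrite -subr_eq0 -normc_eq0 eq_le normc_ge0 andbT.
apply/ler_addgt0Pr => eps e0; rewrite add0r.
pose K := nm S + nm T + 1.
have K1 : 1 <= K by have := normc_ge0 S; have := normc_ge0 T; rewrite /K; lra.
pose d := Num.min 1 (eps / (2 * K)).
have d0 : 0 < d by rewrite lt_min ltr01 divr_gt0 //; lra.
have [s1 h1] := fS _ d0; have [s2 h2] := gT _ d0.
have [s3 h3] := hU _ (divr_gt0 e0 (ltr0n _ 2)).
pose t1 := undup (s1 ++ map fst s3); pose t2 := undup (s2 ++ map snd s3).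
have {}h1 : nm (\sum_(i <- t1) f i - S) < d.
  by apply: h1 => [|i si]; rewrite ?undup_uniq// mem_undup mem_cat si.
have {}h2 : nm (\sum_(i <- t2) g i - T) < d.
  by apply: h2 => [|i si]; rewrite ?undup_uniq// mem_undup mem_cat si.
have {}h3 : nm ((\sum_(i <- t1) f i) * (\sum_(j <- t2) g j) - U) < eps / 2.
  have := h3 [seq (i, j) | i <- t1, j <- t2].
  rewrite big_allpairs_dep /=; under eq_bigr do rewrite -mulr_sumr.
  rewrite -mulr_suml; apply.
    by apply: allpairs_uniq; rewrite ?undup_uniq // => -[a b] [c e] _ _ [-> ->].
  move=> -[i j] ijs; apply/allpairsP; exists (i, j).
  by rewrite !mem_undup !mem_cat (map_f fst ijs) (map_f snd ijs) !orbT.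
set a := \sum_(i <- t1) f i in h1 h3; set b := \sum_(i <- t2) g i in h2 h3.
have -> : S * T - U = (a * b - U) - ((a - S) * (b - T) + (a - S) * T + S * (b - T)).
  by ring.
apply: le_trans (normc_triangle _ _) _; rewrite normc_opp.
have e1 := normc_triangle ((a - S) * (b - T) + (a - S) * T) (S * (b - T)).
have e2 := normc_triangle ((a - S) * (b - T)) ((a - S) * T).
rewrite !normcMl in e1 e2.
have d1 : d <= 1 by rewrite ge_min lexx.
have d2 : d * (2 * K) <= eps.
  by rewrite -ler_pdivlMr ?ge_min ?lexx ?orbT //; lra.
have := normc_ge0 (a - S); have := normc_ge0 (b - T).
have := normc_ge0 S; have := normc_ge0 T.
move: e1 e2 h1 h2 h3 d2; rewrite /K.
move: (nm ((a - S) * (b - T) + (a - S) * T + S * (b - T))) => z2.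
move: (nm ((a - S) * (b - T) + (a - S) * T)) => z3.
move: (nm (a - S)) (nm (b - T)) (nm S) (nm T) (nm (a * b - U)) => x y u v z1.
move=> e1 e2 h1 h2 h3 d2 v0 u0 y0 x0.
have p1 : x * y <= d by nra.
have p2 : x * v <= d * v by nra.
have p3 : u * y <= u * d by nra.
by nra.
Qed.

End UnorderedSum.

(** * The exponential and complex differentiation *)

Section Exponential.
Variable R : realType.
Local Notation C := R[i].
Local Notation nm := (@Normc.normc R).
Implicit Types z w : C.

Lemma cexpD z w : cexp (z + w) = cexp z * cexp w.
Proof.
case: z w => [a b] [c d]; rewrite /cexp /= expRD cosD sinD.
by apply/eqP; rewrite eq_complex /=; apply/andP; split; apply/eqP; ring.
Qed.

Lemma cexp0 : cexp 0 = 1 :> C.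
Proof.
by rewrite /cexp /= expR0 cos0 sin0; apply/eqP; rewrite eq_complex /=;
  apply/andP; split; apply/eqP; ring.
Qed.

Lemma normc_cexp z : nm (cexp z) = expR (complex.Re z).
Proof.
rewrite /cexp normcMl normc_real ger0_norm ?expR_ge0 //.
by rewrite /Normc.normc cos2Dsin2 sqrtr1 mulr1.
Qed.

Lemma eD z w : e (z + w) = e z * e w.
Proof. by rewrite /e mulrDr cexpD. Qed.

Lemma e0 : e 0 = 1 :> C.
Proof. by rewrite /e mulr0 cexp0. Qed.

Lemma e_neq0 z : e z != 0.
Proof.
apply/eqP => ez0; have := e0; rewrite -(subrr z) eD ez0 mul0r.
by move/eqP; rewrite eq_sym oner_eq0.
Qed.

Lemma eN z : e (- z) = (e z)^-1.
Proof.
by apply: (mulfI (e_neq0 z)); rewrite -eD subrr e0 mulfV ?e_neq0.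
Qed.

Lemma eB z w : e (z - w) = e z / e w. Proof. by rewrite eD eN. Qed.

Lemma e_natl n z : e (n%:R * z) = e z ^+ n.
Proof.
elim: n => [|n IH]; first by rewrite mul0r e0.
by rewrite -natr1 mulrDl mul1r eD IH exprSr.
Qed.

Lemma normc_e z : nm (e z) = expR (- (2 * pi * complex.Im z)).
Proof. by case: z => a b; rewrite /e normc_cexp /= mul0r add0r. Qed.

Lemma e1 : e 1 = 1 :> C.
Proof.
rewrite /e mulr1 /cexp /= expR0 mulr_natl cos2pi sin2pi.
by apply/eqP; rewrite eq_complex /=; apply/andP; split; apply/eqP; ring.
Qed.

Lemma e_int (m : int) : e m%:~R = 1 :> C.
Proof.
have en k : e k%:R = 1 :> C by rewrite -[k%:R]mulr1 e_natl e1 expr1n.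
by case: m => m; rewrite ?NegzE ?mulrNz ?eN -pmulrn en ?invr1.
Qed.

Lemma e_half : e (2^-1) = -1 :> C.
Proof.
have -> : 2^-1 = (2^-1 : R)%:C :> C by rewrite fmorphV rmorph_nat.
have -> : e (2^-1)%:C = cexp (0 +i* pi) :> C.
  congr cexp; apply/eqP; rewrite eq_complex /=.
  by apply/andP; split; apply/eqP; field.
rewrite /cexp /= expR0 cospi sinpi.
by apply/eqP; rewrite eq_complex /=; apply/andP; split; apply/eqP; ring.
Qed.

(** The modulus leaves no imaginary part. For the fractional part [f] of the real
    part, [cos (2 pi f) = 1] forces [sin (pi f) = 0]. *)
Lemma e_eq1 z : e z = 1 -> exists m : int, z = m%:~R.
Proof.
move=> ez; have := normc_e z; rewrite ez Normc.normc1 => /esym.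
rewrite -[X in _ = X]expR0 => /expR_inj/eqP.
rewrite oppr_eq0 !mulf_eq0 pnatr_eq0 /= (gt_eqF (pi_gt0 R)) /=.
case: z ez => a b /= ez /eqP b0; move: ez; rewrite {}b0 => ez.
pose m := Num.floor a; exists m.
have /andP[] := floor_itv a; rewrite -/m rmorphD /=.
set f := a - m%:~R => ma am.
have f0 : 0 <= f by rewrite subr_ge0.
have f1 : f < 1 by rewrite ltrBlDl.
have ef : e f%:C = 1 :> C.
  have -> : f%:C = a%:C - m%:~R :> C by rewrite /f rmorphB rmorph_int.
  by rewrite eB e_int ez divr1.
have sf : sin (pi * f) = 0.
  move: ef; rewrite /e /cexp /= !(mul0r, mulr0, subr0, addr0) expR0 => -[].
  rewrite !(mul0r, mul1r, subr0, add0r) -(mulrA 2) mulr_natl cos_mulr2n cos2sin2 => h _.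
  by apply/eqP; rewrite -sqrf_eq0; apply/eqP; move: h; lra.
suff f00 : f = 0.
  have -> : a = m%:~R by apply/eqP; rewrite -subr_eq0 -/f f00.
  by rewrite complexr0 rmorph_int.
apply/eqP; rewrite eq_le f0 andbT leNgt; apply/negP => fgt.
have : 0 < sin (pi * f).
  apply: sin_gt0_pi; rewrite mulr_gt0 ?pi_gt0 //=.
  by rewrite -[ltRHS]mulr1 ltr_pM2l ?pi_gt0.
by rewrite sf ltxx.
Qed.

End Exponential.

Section ComplexDerivative.
Variable R : realType.
Local Notation C := R[i].
Local Notation nm := (@Normc.normc R).
Implicit Types (f : C -> C) (z d : C).

(** First-order approximation; convenient for estimates with real bounds. *)
Definition has_cderiv f z d := forall eps : R, 0 < eps ->
  exists2 del : R, 0 < del & forall h, nm h < del ->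
    nm (f (z + h) - f z - d * h) <= eps * nm h.

Lemma has_cderiv_cvg f z d : has_cderiv f z d ->
  (f (z + h) - f z) / h @[h --> 0^'] --> d.
Proof.
move=> fd; apply/cvg_normcP => eps e0.
have [del d0 hd] := fd _ (divr_gt0 e0 (ltr0n _ 2)).
have : \forall h \near (0 : C), nm h < del.
  have /cvg_normcP/(_ _ d0) : (h @[h --> (0 : C)] --> (0 : C)) by exact: cvg_id.
  by apply: filterS => h; rewrite subr0.
rewrite near_withinE; apply: filterS => h hdel h0.
have -> : (f (z + h) - f z) / h - d = (f (z + h) - f z - d * h) / h.
  by rewrite [in RHS]mulrBl mulfK.
rewrite normcMl Normc.normcV ltr_pdivrMr ?normc_gt0 //.
apply: le_lt_trans (hd _ hdel) _.
by rewrite ltr_pM2r ?normc_gt0 //; lra.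
Qed.

Lemma cvg_has_cderiv f z d :
  (f (z + h) - f z) / h @[h --> 0^'] --> d -> has_cderiv f z d.
Proof.
move=> /cvg_normcP fd eps e0; have := fd _ e0; rewrite near_withinE.
rewrite -nbhs_nearE -nbhs_ballE => -[r /= r0 hr].
have rE : r = (complex.Re r)%:C.
  by case: r r0 {hr} => a b; rewrite ltcE /= => /andP[/eqP -> _].
exists (complex.Re r); first by rewrite -ltcR -rE.
move=> h hlt; have [->|h0] := eqVneq h 0.
  by rewrite addr0 subrr mulr0 subr0 Normc.normc0 mulr0.
have hb : ball (0 : C) r h.
  rewrite -ball_normE /ball_ /= sub0r normrN.
  by have : (nm h)%:C < r :> C by rewrite rE ltcR.
have := ltW (hr h hb h0).
rewrite -(ler_pM2r (x := nm h)) ?normc_gt0 // -normcMl.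
by rewrite mulrBl divfK.
Qed.

Lemma has_cderiv_derivable f z d : has_cderiv f z d -> derivable f z 1.
Proof.
move=> /has_cderiv_cvg fd; apply/cvg_ex; exists d.
rewrite [X in X @ _](_ : _ = fun h => (f (z + h) - f z) / h) //.
by apply/funext => h; rewrite /= [h%:A]mulr1 [h + z]addrC mulrC.
Qed.

Lemma has_cderiv_affine f a b z d :
  has_cderiv f (a * z + b) d -> has_cderiv (fun w => f (a * w + b)) z (a * d).
Proof.
move=> fd eps e0.
have a1 : 0 < nm a + 1 by have := normc_ge0 a; lra.
have [del d0 hd] := fd _ (divr_gt0 e0 a1).
exists (del / (nm a + 1)); first exact: divr_gt0.
move=> h; rewrite ltr_pdivlMr // => hlt.
have ah : nm (a * h) < del.
  rewrite normcMl; apply: le_lt_trans hlt.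
  by rewrite mulrC ler_wpM2l ?normc_ge0 // lerDl.
have -> : a * (z + h) + b = a * z + b + a * h by ring.
have -> : a * d * h = d * (a * h) by ring.
apply: le_trans (hd _ ah) _.
rewrite normcMl mulrA ler_wpM2r ?normc_ge0 //.
by rewrite mulrAC ler_pdivrMr // ler_wpM2l ?(ltW e0) // lerDl.
Qed.

Lemma is_derive_approx (f : R -> R) (d eps : R) : is_derive (0 : R) 1 f d ->
  0 < eps -> exists2 del : R, 0 < del & forall x : R, `|x| < del ->
    `|f x - f 0 - d * x| <= eps * `|x|.
Proof.
move=> [df fd] e0.
have : h^-1 *: (f (h *: 1 + 0) - f 0) @[h --> 0^'] --> d by rewrite -fd.
move=> /cvgrPdist_lt/(_ _ e0); rewrite near_withinE -nbhs_nearE -nbhs_ballE.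
move=> -[r /= r0 hr]; exists r => // x xr.
have [->|x0] := eqVneq x 0.
  by rewrite subrr mulr0 subr0 normr0 mulr0.
have := hr x; rewrite /ball /= sub0r normrN => /(_ xr x0)/ltW.
rewrite -(ler_pM2r (x := `|x|)) ?normr_gt0 // -normrM addr0 distrC.
by rewrite [x *: 1]mulr1 /GRing.scale /= mulrBl mulrAC mulVf // mul1r.
Qed.

Lemma normc_le_ReIm z : nm z <= `|complex.Re z| + `|complex.Im z|.
Proof.
case: z => a b /=; rewrite -(@ler_pXn2r _ 2) ?nnegrE ?sqrtr_ge0 ?addr_ge0 //.
rewrite sqr_sqrtr ?addr_ge0 ?sqr_ge0 // sqrrD -!normrX.
rewrite !(ger0_norm (sqr_ge0 _)) addrAC lerDl mulrn_wge0 // mulr_ge0.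
Qed.

(** From the derivatives at [0] of the real exponential, cosine and sine, one
    coordinate at a time. *)
Lemma cexp_cderiv0 : has_cderiv (@cexp R) 0 1.
Proof.
(* The two coordinates of the error are at most [3 c n] and [3 c n], where [n]
   is the modulus of the increment. *)
move=> eps e0; pose c := Num.min 1 (eps / 10).
have c0 : 0 < c by rewrite lt_min ltr01 divr_gt0.
have c1 : c <= 1 by rewrite ge_min lexx.
have ce : 10 * c <= eps by rewrite mulrC -ler_pdivlMr // ge_min lexx orbT.
have [d1 d10 hE] := is_derive_approx (is_derive_expR (0 : R)) c0.
have [d2 d20 hC] := is_derive_approx (is_derive_cos (0 : R)) c0.
have [d3 d30 hS] := is_derive_approx (is_derive_sin (0 : R)) c0.
exists (Num.min (Num.min d1 (c / 2)) (Num.min d2 d3)).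
  by rewrite !lt_min d10 d20 d30 divr_gt0.
move=> h; rewrite !lt_min => /andP[/andP[h1 h1'] /andP[h2 h3]].
have ra := normc_Re h; have ib := normc_Im h.
rewrite add0r cexp0 mul1r; apply: le_trans (normc_le_ReIm _) _.
have n0 := normc_ge0 h; move: (nm h) h1 h1' h2 h3 ra ib n0 => n.
case: h => a b h1 h1' h2 h3 /= ra ib n0.
have := hE a (le_lt_trans ra h1); have := hC b (le_lt_trans ib h2).
have := hS b (le_lt_trans ib h3).
rewrite expR0 cos0 sin0 oppr0 mul0r !mul1r ?subr0 ?addr0 /cexp /= => eS eC eE.
rewrite !(mul0r, subr0, addr0).
have Ea : `|expR a| <= 2.
  rewrite ger0_norm ?expR_ge0 //; move: eE; rewrite ler_norml => /andP[_].
  have := ler_norm a; nra.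
have Ea1 : `|expR a - 1| <= c.
  have -> : expR a - 1 = expR a - 1 - a + a by ring.
  apply: le_trans (ler_normD _ _) _; nra.
have -> : expR a * cos b - 1 - a = expR a * (cos b - 1) + (expR a - 1 - a).
  by ring.
have -> : expR a * sin b - b = expR a * (sin b - b) + (expR a - 1) * b.
  by ring.
have t1 := ler_normD (expR a * (cos b - 1)) (expR a - 1 - a).
have t2 := ler_normD (expR a * (sin b - b)) ((expR a - 1) * b).
rewrite !normrM in t1 t2.
have u1 : `|expR a| * `|cos b - 1| <= 2 * (c * n).
  by apply: ler_pM => //; apply: le_trans eC _; rewrite ler_wpM2l // ltW.
have u2 : `|expR a| * `|sin b - b| <= 2 * (c * n).
  by apply: ler_pM => //; apply: le_trans eS _; rewrite ler_wpM2l // ltW.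
have u3 : `|expR a - 1| * `|b| <= c * n by exact: ler_pM.
have u4 : `|expR a - 1 - a| <= c * n.
  by apply: le_trans eE _; rewrite ler_wpM2l // ltW.
have u5 : 10 * c * n <= eps * n by rewrite ler_wpM2r.
have cn : 0 <= c * n by rewrite mulr_ge0 // ltW.
move: t1 t2 u1 u2 u3 u4 u5 cn.
move: `|expR a * _ + _| `|expR a * _ + _| => x y.
move: (`|expR a| * `|cos b - 1|) (`|expR a| * `|sin b - b|) => p q.
move: (`|expR a - 1| * _) (`|expR a - 1 - a|) => r s.
by lra.
Qed.

Lemma cexp_cderiv z : has_cderiv (@cexp R) z (cexp z).
Proof.
move=> eps e0.
have a1 : 0 < nm (cexp z) + 1 by have := normc_ge0 (cexp z); lra.
have [del d0 hd] := cexp_cderiv0 (divr_gt0 e0 a1).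
exists del => // h hlt; have := hd h hlt.
rewrite add0r cexp0 mul1r cexpD => k.
have -> : cexp z * cexp h - cexp z - cexp z * h
  = cexp z * (cexp h - 1 - h) by ring.
rewrite normcMl; apply: le_trans (ler_wpM2l (normc_ge0 _) k) _.
rewrite mulrA ler_wpM2r ?normc_ge0 // mulrCA -[leRHS]mulr1.
by rewrite ler_wpM2l ?(ltW e0) // ler_pdivrMr // mul1r lerDl.
Qed.

Definition i2pi : C := 0 +i* (2 * pi).

Lemma e_cderiv (a b z : C) :
  has_cderiv (fun w => e (a * w + b)) z (a * i2pi * e (a * z + b)).
Proof.
have := @has_cderiv_affine (@cexp R) (i2pi * a) (i2pi * b) z
  (cexp (i2pi * (a * z + b))).
rewrite mulrDr mulrA => /(_ (cexp_cderiv _)) h eps /h[del d0 hd].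
exists del => // k /hd; rewrite /e -/i2pi.
rewrite !mulrDr !mulrA !(mulrC i2pi a) => hh.
exact: hh.
Qed.

End ComplexDerivative.

(** * Gaussian series over the integers *)

Section IntegerSums.
Variable R : realType.
Local Notation C := R[i].
Local Notation nm := (@Normc.normc R).

Lemma nat_dominated_sum (g : nat -> R) (B : R) : (forall k, 0 <= g k) ->
  (forall N, \sum_(k < N) g k <= B) -> dominated_sum g.
Proof.
move=> g0 hB; exists B => s us.
pose N := (\max_(i <- s) i).+1.
have sub : {subset s <= index_iota 0 N}.
  by move=> i si; rewrite mem_index_iota /= ltnS; exact: leq_bigmax_seq.
apply: le_trans (hB N); rewrite -(big_mkord xpredT g).
by rewrite (big_subset_split _ us (iota_uniq _ _) sub) lerDl sumr_ge0.
Qed.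

Lemma has_sum_series (f : nat -> C) S : has_sum f S ->
  series f @ \oo --> S.
Proof.
move=> fS; apply/cvg_normcP => eps /fS[s0 hs0].
exists (\max_(i <- s0) i).+1 => // N /= hN.
rewrite /series /=; apply: hs0; first exact: iota_uniq.
move=> i si; rewrite mem_index_iota /=; apply: leq_trans hN.
by rewrite ltnS; exact: leq_bigmax_seq.
Qed.

Definition int_of_sum (x : nat + nat) : int :=
  match x with inl k => Posz k | inr k => Negz k end.

Lemma int_of_sum_bij : bijective int_of_sum.
Proof.
by exists (fun m => match m with Posz k => inl k | Negz k => inr k end);
  case.
Qed.

Lemma dominated_sum_int (g : int -> R) :
  dominated_sum (fun k => g (Posz k)) -> dominated_sum (fun k => g (Negz k)) ->
  dominated_sum g.
Proof.
move=> gp gn; have [h hk kh] := int_of_sum_bij.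
have := @dominated_sum_sum _ _ _ (g \o int_of_sum) gp gn.
move=> /(dominated_sum_inj (can_inj kh)) [B hB].
by exists B => s /hB; under eq_bigr do rewrite /= kh.
Qed.

(** The two one-sided series of [zsum] are the halves of the unordered sum. *)
Lemma abs_summable_zsum (a : int -> C) : abs_summable a -> has_sum a (zsum a).
Proof.
move=> sa.
have [A hA] : exists S, has_sum (fun k => a (Posz k)) S.
  by apply: abs_summable_has_sum; apply: dominated_sum_inj sa => i j [].
have [B hB] : exists S, has_sum (fun k => a (Negz k)) S.
  by apply: abs_summable_has_sum; apply: dominated_sum_inj sa => i j [].
have -> : zsum a = A + B.
  congr (_ + _); apply: (cvg_lim (@norm_hausdorff _ _));
    exact: has_sum_series.
have [h hk kh] := int_of_sum_bij.
have := has_sum_sum (f := a \o int_of_sum) hA hB.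
move=> /(has_sum_reindex (Bijective kh hk)).
by apply: eq_has_sum => m /=; rewrite kh.
Qed.

(** Comparison with a geometric series of ratio [1/2]: adding twice the next
    term to the partial sums makes them nonincreasing. *)
Lemma halving_dominated_sum (g : nat -> R) (M : nat) : (forall k, 0 <= g k) ->
  (forall k, (M <= k)%N -> g k.+1 <= g k / 2) -> dominated_sum g.
Proof.
move=> g0 gh; pose B := \sum_(k < M) g k + 2 * g M.
have hB N : \sum_(k < M + N) g k + 2 * g (M + N)%N <= B.
  elim: N => [|N]; first by rewrite addn0.
  rewrite addnS big_ord_recr /=; have := gh _ (leq_addr N M).
  by move: (\sum_(_ < _) _) => x; lra.
apply: (nat_dominated_sum (B := B)) => // N.
apply: (@le_trans _ _ (\sum_(k < M + N) g k)).
  rewrite -!(big_mkord xpredT g) /= [leRHS](big_cat_nat (n := N)) ?leq_addl //=.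
  by rewrite lerDl sumr_ge0.
by have := hB N; have := g0 (M + N)%N; lra.
Qed.

Lemma expr_le_eventually (t eps : R) : 0 <= t < 1 -> 0 < eps ->
  exists M, forall k, (M <= k)%N -> t ^+ k <= eps.
Proof.
move=> /andP[t0 t1] e0; have : `|t| < 1 by rewrite ger0_norm.
move=> /cvg_expr/cvgrPdist_lt/(_ _ e0)[M _ hM]; exists M => k /hM /=.
by rewrite sub0r normrN ger0_norm ?exprn_ge0 // => /ltW.
Qed.

(** The exponent [m (m - 1) / 2] of the theta series, as a natural number. *)
Definition tri (m : int) : nat :=
  match m with Posz k => 'C(k, 2) | Negz k => 'C(k.+2, 2) end.

Lemma triE m : (tri m)%:Z * 2 = m * (m - 1).
Proof.
have bin2E k : ('C(k, 2) * 2 = k * k.-1)%N.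
  by rewrite bin2 muln2 halfK -modn2 modn2 oddM; case: k => //= k;
    case: (odd k); rewrite subn0.
case: m => k; rewrite /tri.
  by have := bin2E k; case: k => [|k]; rewrite ?bin0n //=; lia.
by have := bin2E k.+2; rewrite /=; lia.
Qed.

(** The ratio of the consecutive terms [k] and [k + 1] is [t ^+ k * y], which
    tends to [0]. *)
Lemma gauss_dominated (t y : R) : 0 <= t < 1 -> 0 <= y ->
  dominated_sum (fun m : int => t ^+ tri m * y ^+ `|m|%N).
Proof.
move=> t01 y0; have /andP[t0 t1] := t01.
have y1 : 0 < 2 * (y + 1) by lra.
have pos : dominated_sum (fun k => t ^+ 'C(k, 2) * y ^+ k).
  have [M hM] := expr_le_eventually t01 (divr_gt0 ltr01 y1).
  apply: (@halving_dominated_sum _ M) => [k|k /hM].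
    by rewrite mulr_ge0 ?exprn_ge0.
  rewrite ler_pdivlMr // binS bin1 exprD exprS.
  have p0 : 0 <= t ^+ 'C(k, 2) by exact: exprn_ge0.
  have q0 : 0 <= y ^+ k by exact: exprn_ge0.
  have r0 : 0 <= t ^+ k by exact: exprn_ge0.
  have := mulr_ge0 p0 q0; move: (t ^+ k) r0 => r r0 z0 hr.
  rewrite mulrACA; have -> : t ^+ 'C(k, 2) * y * (r * y ^+ k)
    = (t ^+ 'C(k, 2) * y ^+ k) * (r * y) by ring.
  by move: (_ * _) z0 => z z0; nra.
apply: dominated_sum_int => //.
apply: (dominated_sum_le (g := (fun k => t ^+ 'C(k, 2) * y ^+ k) \o succn)).
  move=> k /=; rewrite ler_wpM2r ?exprn_ge0 // binS exprD -[leRHS]mulr1.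
  by rewrite ler_wpM2l ?exprn_ge0 // exprn_ile1 // ltW.
by apply: dominated_sum_inj pos => i j [].
Qed.

End IntegerSums.

(** Fubini on the sum over pairs [(m, l)], split by the parity of [m + l]:
    [(t + d, t - d)] and [(t + d, t + 1 - d)] decouple the quadratic exponent. *)
Definition parity_pair (p : int * int + int * int) : int * int :=
  match p with
  | inl (t, d) => (t + d, t - d)
  | inr (t, d) => (t + d, t + 1 - d)
  end.

Lemma parity_pair_bij : bijective parity_pair.
Proof.
exists (fun p => let t := ((p.1 + p.2) %/ 2)%Z in
  if ((p.1 + p.2) %% 2)%Z == 0 then inl (t, p.1 - t) else inr (t, p.1 - t)).
- case=> -[t d] /=.
  + have -> : t + d + (t - d) = t * 2 by ring.
    by rewrite modzMl mulzK //= addrAC subrr add0r.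
  + have -> : t + d + (t + 1 - d) = t * 2 + 1 by ring.
    by rewrite modzMDl divzMDl //= addr0 addrAC subrr add0r.
- case=> m l /=.
  have := divz_eq (m + l) 2; have := modz_ge0 (m + l) (isT : (2 : int) != 0).
  have := ltz_mod (m + l) (isT : (2 : int) != 0).
  move: ((m + l) %/ 2)%Z ((m + l) %% 2)%Z => t r r2 r0 E.
  by case: eqP => r00 /=; congr pair; lia.
Qed.

Section Theta.
Variables (R : realType) (eta : R[i]).
Hypothesis eta_upper : 0 < complex.Im eta.
Local Notation C := R[i].
Local Notation nm := (@Normc.normc R).
Implicit Types x y z : C.

Definition gauss_term (z : C) (m : int) : C :=
  e (m%:~R * z + (m * (m - 1))%:~R / 2 * eta).

Definition gauss_sum (z : C) : C := zsum (gauss_term z).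

Definition nome : R := expR (- (2 * pi * complex.Im eta)).
Definition growth (z : C) : R := expR (2 * pi * `|complex.Im z|).

Lemma nome_lt1 : 0 <= nome < 1.
Proof.
rewrite /nome expR_ge0 -[ltRHS]expR0 ltr_expR oppr_lt0.
by rewrite !mulr_gt0 ?pi_gt0.
Qed.

Lemma ImD (a b : C) : complex.Im (a + b) = complex.Im a + complex.Im b.
Proof. by case: a b => [? ?] []. Qed.

Lemma Im_intM (m : int) (a : C) : complex.Im (m%:~R * a) = m%:~R * complex.Im a.
Proof.
have -> : m%:~R = (m%:~R)%:C :> C by rewrite rmorph_int.
by case: a => a b /=; rewrite mul0r addr0.
Qed.

Lemma gauss_term_norm z m :
  nm (gauss_term z m) <= nome ^+ tri m * growth z ^+ `|m|%N.
Proof.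
rewrite /gauss_term.
have -> : (m * (m - 1))%:~R / 2 * eta = ((tri m)%:Z)%:~R * eta.
  by rewrite -triE intrM mulfK // pnatr_eq0.
rewrite normc_e ImD !Im_intM /nome /growth -!expRM_natl -expRD.
rewrite ler_expR mulrDr opprD [leLHS]addrC; apply: lerD.
  by rewrite -!pmulrn mulrN mulrCA.
rewrite [leRHS]mulrCA -[leLHS]mulrN ler_pM2l ?mulr_gt0 ?pi_gt0 //.
have -> : `|m|%N%:R = `|m%:~R| :> R by rewrite -intr_norm pmulrn abszE.
by rewrite -normrM -normrN ler_norm.
Qed.

(** The factor [c ^+ `|m|] leaves room for the derivative of the terms in [z]
    ([c = 4]) and for perturbed coefficients ([c = 1]). *)
Lemma gauss_term_dominated z K (c : R) : 0 <= K -> 1 <= c ->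
  dominated_sum (fun m => K * c ^+ `|m|%N * (nome ^+ tri m * growth z ^+ `|m|%N)).
Proof.
move=> K0 c1.
have cg0 : 0 <= c * growth z by rewrite mulr_ge0 ?expR_ge0 //; lra.
apply: dominated_sum_le (dominated_sumZ K0 (gauss_dominated nome_lt1 cg0)) => m.
by rewrite exprMn le_eqVlt; apply/orP; left; apply/eqP; ring.
Qed.

Lemma gauss_summable z : abs_summable (gauss_term z).
Proof.
apply: dominated_sum_le (gauss_dominated nome_lt1 (expR_ge0 _)).
exact: gauss_term_norm.
Qed.

Lemma gauss_has_sum z : has_sum (gauss_term z) (gauss_sum z).
Proof. exact/abs_summable_zsum/gauss_summable. Qed.

Lemma sign_e (m : int) : (-1) ^ m = e (m%:~R / 2) :> C.
Proof.
have en k : e (k%:R / 2) = (-1) ^+ k :> C by rewrite e_natl e_half.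
case: m => k; first by rewrite -exprnP -en -pmulrn.
by rewrite NegzE mulrNz mulNr eN -pmulrn en -exprnN.
Qed.

(** The signs of the theta series are absorbed by a shift of [z] by [1/2]. *)
Lemma theta_gauss z : theta eta z = gauss_sum (z + 2^-1).
Proof.
rewrite /theta /gauss_sum; congr zsum; apply/funext => m.
by rewrite sign_e -eD /gauss_term; congr e; ring.
Qed.

Lemma gauss_sumD1 z : gauss_sum (z + 1) = gauss_sum z.
Proof.
congr zsum; apply/funext => m.
rewrite /gauss_term; have -> : m%:~R * (z + 1) + (m * (m - 1))%:~R / 2 * eta
  = m%:~R * z + (m * (m - 1))%:~R / 2 * eta + m%:~R by ring.
by rewrite eD e_int mulr1.
Qed.

Lemma gauss_sum_eta z : gauss_sum (z + eta) = e (- z) * gauss_sum z.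
Proof.
apply: has_sum_uniq (gauss_has_sum _) _.
have b : bijective (fun m : int => m + 1).
  by exists (fun m => m - 1) => m; rewrite ?addrK ?subrK.
apply: eq_has_sum (has_sumZ _ (has_sum_reindex b (gauss_has_sum z))) => m /=.
by rewrite /gauss_term -eD; congr e; field.
Qed.

Lemma gauss_sum_opp z : gauss_sum (2^-1 - z) = - e (- z) * gauss_sum (z + 2^-1).
Proof.
apply: has_sum_uniq (gauss_has_sum _) _.
have b : bijective (fun m : int => 1 - m).
  by exists (fun m => 1 - m) => m; rewrite subKr.
apply: eq_has_sum (has_sumZ _ (has_sum_reindex b (gauss_has_sum _))) => m /=.
rewrite /gauss_term mulNr -mulN1r -e_half -!eD.
rewrite -[RHS]mulr1 -[X in _ = _ * X](e_int R (1 - m)) -eD.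
by congr e; field.
Qed.

Lemma thetaD1 z : theta eta (z + 1) = theta eta z.
Proof. by rewrite !theta_gauss addrAC gauss_sumD1. Qed.

Lemma theta_eta z : theta eta (z + eta) = - e (- z) * theta eta z.
Proof.
rewrite !theta_gauss addrAC gauss_sum_eta opprD eB e_half.
by rewrite invrN invr1 mulrN1.
Qed.

Lemma theta_opp z : theta eta (- z) = - e (- z) * theta eta z.
Proof. by rewrite !theta_gauss addrC gauss_sum_opp. Qed.

Lemma has_sum_theta z : has_sum (gauss_term (z + 2^-1)) (theta eta z).
Proof. by rewrite theta_gauss; exact: gauss_has_sum. Qed.

End Theta.

Section ThetaTheory.
Variables (R : realType) (eta : R[i]).
Hypothesis eta_upper : 0 < complex.Im eta.
Local Notation C := R[i].
Local Notation nm := (@Normc.normc R).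
Implicit Types x y z : C.

(** The three-term identity: products of shifted theta functions are
    two-by-two determinants in the theta functions for [2 * eta]. *)
Lemma theta_three_term : exists A B : C -> C, forall x y,
  theta eta (x + y) * theta eta (x - y) = e x * (A x * B y - B x * A y).
Proof.
have eta2 : 0 < complex.Im (2 * eta).
  by rewrite -[2]/(2%:~R) Im_intM mulr_gt0.
(* With [(m, l) = (t + d, t - d)] one has [m (x + y) + l (x - y) = 2 t x + 2 d y],
   and the quadratic exponent is [(t (t - 1) + d (d - 1) + d) eta]. *)
pose G := gauss_sum (2 * eta).
pose A x := e (- x) * G (2 * x); pose B x := G (2 * x + eta).
exists A, B => x y.
have h1 := has_sum_prod (gauss_summable eta_upper _)
  (gauss_summable eta_upper _) (has_sum_theta eta_upper (x + y))
  (has_sum_theta eta_upper (x - y)).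
have h2 := has_sum_prod (gauss_summable eta2 _) (gauss_summable eta2 _)
  (gauss_has_sum eta2 (2 * x)) (gauss_has_sum eta2 (2 * y + eta)).
have h3 := has_sum_prod (gauss_summable eta2 _) (gauss_summable eta2 _)
  (gauss_has_sum eta2 (2 * x + eta)) (gauss_has_sum eta2 (2 * y)).
have {}h3 := has_sumZ (- e (x - y)) h3.
have {}h1 := has_sum_reindex parity_pair_bij h1.
apply: (has_sum_uniq h1).
have -> : e x * (A x * B y - B x * A y)
    = G (2 * x) * G (2 * y + eta)
      + - e (x - y) * (G (2 * x + eta) * G (2 * y)).
  rewrite /A /B eB !eN; move: (e x) (e y) (e_neq0 x) (e_neq0 y) => u v u0 v0.
  by field; rewrite u0 v0.
apply: has_sum_sum; [apply: eq_has_sum h2|apply: eq_has_sum h3];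
  case=> t d /=; rewrite /gauss_term.
- rewrite -!eD -[RHS]mulr1.
  rewrite -[X in _ = _ * X](e_int R (- t)) -eD; congr e.
  by field.
- rewrite mulNr -mulN1r -e_half -!eD.
  rewrite -[RHS]mulr1 -[X in _ = _ * X](e_int R (- t)) -eD; congr e.
  by field.
Qed.

Lemma normc_exprB1 (a : C) k : nm a <= 2 ->
  nm (a ^+ k - 1) <= k%:R * 2 ^+ k * nm (a - 1).
Proof.
move=> a2; elim: k => [|k IH]; first by rewrite subrr Normc.normc0 !mul0r.
have -> : a ^+ k.+1 - 1 = a ^+ k * (a - 1) + (a ^+ k - 1).
  by rewrite exprSr; ring.
apply: le_trans (normc_triangle _ _) _; rewrite normcMl normcX.
have ak : nm a ^+ k <= 2 ^+ k by rewrite lerXn2r ?nnegrE ?normc_ge0.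
have d0 := normc_ge0 (a - 1); have k0 : 0 <= 2 ^+ k :> R by exact: exprn_ge0.
have kn : 0 <= k%:R :> R by exact: ler0n.
rewrite exprS -natr1; have p1 := ler_wpM2r d0 ak.
have p2 := mulr_ge0 (mulr_ge0 kn k0) d0; have p3 := mulr_ge0 k0 d0.
move: IH p1 p2 p3; move: (nm (a ^+ k - 1)) (nm (a - 1)) (nm a ^+ k) => u v w.
move: (2 ^+ k) (k%:R) => p q; lra.
Qed.

(** A Lipschitz bound for the exponentials of the theta series, uniform up to a
    geometric factor in [m]: the majorant for term-by-term differentiation. *)
Lemma e_near0 : exists2 K : R, 0 <= K & exists2 del : R, 0 < del &
  forall h, nm h < del -> forall m : int,
  nm (e (m%:~R * h) - 1) <= K * 4 ^+ `|m|%N * nm h.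
Proof.
have one c : exists2 K : R, 0 <= K & exists2 del : R, 0 < del &
    forall h, nm h < del -> nm (e (c * h) - 1) <= K * nm h /\ nm (e (c * h)) <= 2.
  have [del d0 hd] := e_cderiv c 0 0 ltr01.
  move: hd; rewrite !(mulr0, addr0, add0r) e0 mulr1; set d := c * _ => hd.
  have K0 : 0 <= nm d by exact: normc_ge0.
  exists (nm d + 1); first by lra.
  have K1 : 0 < nm d + 1 by lra.
  exists (Num.min del (nm d + 1)^-1); first by rewrite lt_min d0 invr_gt0.
  move=> h; rewrite lt_min => /andP[/hd]; rewrite !(addr0, add0r) => h1 h2.
  have h3 : nm (e (c * h) - 1) <= (nm d + 1) * nm h.
    have -> : e (c * h) - 1 = (e (c * h) - 1 - d * h) + d * h by ring.
    apply: le_trans (normc_triangle _ _) _; rewrite normcMl mulrDl addrC.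
    exact: lerD.
  split=> //; have := normc_triangle (e (c * h) - 1) 1.
  rewrite subrK Normc.normc1.
  have : (nm d + 1) * nm h < 1 by rewrite -ltr_pdivlMl // mulr1.
  move: h3; move: (nm (e _ - 1)) (nm (e _)) (nm d) => ? ? ?; lra.
have [K K0 [d1 d10 h1]] := one 1; have [L L0 [d2 d20 h2]] := one (-1).
exists (K + L); first by rewrite addr_ge0.
exists (Num.min d1 d2); first by rewrite lt_min d10.
move=> h; rewrite lt_min => /andP[/h1[a1 a2] /h2[b1 b2]] m.
have pow (a : C) (k : nat) (M : R) : nm a <= 2 -> 0 <= M -> M <= K + L ->
    nm (a - 1) <= M * nm h ->
    nm (a ^+ k - 1) <= (K + L) * 4 ^+ k * nm h.
  move=> a22 M0 ML aM; apply: le_trans (normc_exprB1 k a22) _.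
  rewrite [leRHS]mulrAC [leRHS]mulrC; apply: ler_pM; rewrite ?normc_ge0 //.
  - have -> : 4 = 2 * 2 :> R by ring.
    rewrite exprMn ler_wpM2r ?exprn_ge0 //.
    by rewrite -natrX ler_nat; apply: ltnW; rewrite ltn_expl.
  - by apply: le_trans aM _; rewrite ler_wpM2r ?normc_ge0.
case: m => k.
  rewrite -pmulrn e_natl; apply: (pow _ _ K) => //; rewrite ?lerDl//.
    by move: a2; rewrite mul1r.
  by move: a1; rewrite mul1r.
have -> : (Negz k)%:~R * h = k.+1%:R * (-1 * h).
  by rewrite NegzE mulrNz -pmulrn; ring.
by rewrite e_natl; apply: (pow _ _ L) => //; rewrite ?lerDr.
Qed.

(** Term-by-term differentiation, by dominated convergence of the difference
    quotients. *)
Lemma theta_cderiv z : exists d, has_cderiv (theta eta) z d.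
Proof.
have [K K0 [del d0 hK]] := e_near0.
pose z' := z + 2^-1; pose M := K + 2 * pi.
have M0 : 0 <= M by rewrite addr_ge0 // mulr_ge0 // pi_ge0.
pose g m := M * 4 ^+ `|m|%N * (nome eta ^+ tri m * growth z' ^+ `|m|%N).
have g0 m : 0 <= g m.
  by rewrite !mulr_ge0 ?exprn_ge0 ?expR_ge0.
have sg : dominated_sum g by apply: gauss_term_dominated => //; lra.
pose l m := m%:~R * i2pi R * gauss_term eta z' m.
have lg m : nm (l m) <= g m.
  rewrite /l normcMl; apply: ler_pM; rewrite ?normc_ge0 //; last first.
    exact: gauss_term_norm.
  have -> : nm (m%:~R * i2pi R) = 2 * pi * `|m|%N%:R.
    rewrite normcMl -(rmorph_int (real_complex R)) normc_real -intr_norm.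
    rewrite mulrC [`|m|%N%:R]pmulrn abszE; congr (_ * _).
    rewrite /i2pi /= expr0n /= add0r sqrtr_sqr ger0_norm //.
    by rewrite mulr_ge0 // pi_ge0.
  apply: ler_pM; rewrite ?mulr_ge0 ?pi_ge0 ?ler0n // ?lerDr //.
  by rewrite -natrX ler_nat; apply: ltnW; rewrite ltn_expl.
have [d hd] := abs_summable_has_sum (dominated_sum_le lg sg).
exists d; apply: cvg_has_cderiv.
pose f h m := h^-1 * (gauss_term eta (z' + h) m - gauss_term eta z' m).
have fE h m : f h m = h^-1 * gauss_term eta z' m * (e (m%:~R * h) - 1).
  rewrite /f /gauss_term [m%:~R * (_ + h)]mulrDr [_ + _ * h + _]addrAC.
  by rewrite [e (_ + _ * h)]eD; ring.
apply: (@dominated_has_sum_cvg _ _ _ _ f l g) => //.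
- rewrite near_withinE.
  have : \forall h \near (0 : C), nm h < del.
    have /cvg_normcP/(_ _ d0) : (h @[h --> (0 : C)] --> (0 : C)).
      exact: cvg_id.
    by apply: filterS => h; rewrite subr0.
  apply: filterS => h hdel h0; split.
    rewrite mulrC; apply: has_sumZ; rewrite -[X in _ - X]mul1r.
    rewrite -mulNr.
    apply: eq_has_sum (has_sumD (has_sum_theta eta_upper (z + h))
      (has_sumZ (-1) (has_sum_theta eta_upper z))) => m.
    by rewrite mulN1r /z' addrAC.
  move=> m; rewrite fE mulrAC normcMl; apply: ler_pM; rewrite ?normc_ge0 //.
    rewrite normcMl Normc.normcV mulrC ler_pdivrMr ?normc_gt0 //.
    apply: le_trans (hK _ hdel m) _; rewrite !ler_wpM2r ?normc_ge0 //.
    by rewrite lerDl mulr_ge0 // pi_ge0.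
  exact: gauss_term_norm.
- move=> m.
  have := e_cderiv m%:~R ((m * (m - 1))%:~R / 2 * eta) z'.
  move=> /has_cderiv_cvg; rewrite /l /f -/(gauss_term eta z' m).
  by under eq_fun do rewrite mulrC.
Qed.

End ThetaTheory.

(** * The Jacobi triple product *)

Section QBinomial.
Variables (F : fieldType) (q : F).

Definition qfact (N : nat) : F := \prod_(m < N) (1 - q ^+ m.+1).

Fixpoint qbin (M k : nat) : F :=
  match M, k with
  | _, 0 => 1
  | 0, _.+1 => 0
  | M'.+1, k'.+1 => qbin M' k' + q ^+ k'.+1 * qbin M' k'.+1
  end.

Lemma qbin_small M k : (M < k)%N -> qbin M k = 0.
Proof.
elim: M k => [|M IH] [|k] //= Mk.
by rewrite !IH ?mulr0 ?addr0 // ltnW.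
Qed.

Lemma qbin_fact M k : (k <= M)%N ->
  qbin M k * qfact k * qfact (M - k) = qfact M.
Proof.
elim: M k => [|M IH] [|k] //.
- by rewrite subn0 /qfact /= big_ord0 !mul1r.
- by rewrite subn0 /qfact /= big_ord0 !mul1r.
rewrite ltnS subSS => kM /=; have IHk := IH k kM.
have qS N : qfact N.+1 = qfact N * (1 - q ^+ N.+1) by rewrite /qfact big_ord_recr.
move: kM; rewrite leq_eqVlt => /predU1P[kM|kM].
  rewrite {k}kM in IHk *; rewrite (@qbin_small M M.+1) // mulr0 addr0 !qS.
  by rewrite -[in RHS]IHk; ring.
have := IH _ kM; rewrite -(subnSK kM) !qS => IHS.
have -> : q ^+ M.+1 = q ^+ k.+1 * q ^+ (M - k.+1).+1.
  by rewrite -exprD; congr (q ^+ _); lia.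
set a := qfact (M - k.+1) in IHS *; move: IHk; rewrite -(subnSK kM) qS -/a.
move: (qbin M k) (qbin M k.+1) (qfact k) IHS => u v w.
move: (q ^+ k.+1) (q ^+ (M - k.+1).+1) (qfact M) => x y f.
move=> h1 h2; rewrite mulrDl mulrDl.
rewrite (_ : u * _ * _ = (u * w * (a * (1 - y))) * (1 - x)); last by ring.
rewrite (_ : x * v * _ * _ = (v * (w * (1 - x)) * a) * (x * (1 - y))); last by ring.
by rewrite h1 h2; ring.
Qed.

(** The finite form of the triple product, by induction on the first factor. *)
Lemma qbinomial_theorem M (y : F) :
  \prod_(m < M) (1 + y * q ^+ m)
    = \sum_(k < M.+1) q ^+ 'C(k, 2) * qbin M k * y ^+ k.
Proof.
elim: M y => [|M IH] y.
  by rewrite big_ord0 big_ord_recl big_ord0 /= !mulr1 addr0.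
rewrite big_ord_recl expr0 mulr1.
under eq_bigr => m _ do rewrite lift0 exprS mulrA.
rewrite IH mulrDl mul1r [RHS]big_ord_recl [X in X + _]big_ord_recl /=.
have b0 : qbin M 0 = 1 by case: (M).
rewrite b0 !expr0 !mulr1 -addrA; congr (_ + _).
rewrite [RHS](eq_bigr (fun i : 'I_M.+1 =>
    q ^+ 'C(i.+1, 2) * qbin M i.+1 * (y * q) ^+ i.+1
    + y * (q ^+ 'C(i, 2) * qbin M i * (y * q) ^+ i))) => [|i _]; last first.
  rewrite /bump /= add1n add0n binS bin1 exprD !exprMn exprS [y ^+ i.+1]exprS.
  by rewrite /=; ring.
rewrite big_split /= -mulr_sumr; congr (_ + _).
by rewrite [RHS]big_ord_recr /= qbin_small // mulr0 mul0r addr0.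
Qed.

End QBinomial.

Section ProductBounds.
Variable R : realType.
Local Notation C := R[i].
Local Notation nm := (@Normc.normc R).

Lemma prod_1B_ge_half (u : nat -> C) N :
  (forall N, \sum_(m < N) nm (u m) <= 1 / 2) ->
  1 - \sum_(m < N) nm (u m) <= nm (\prod_(m < N) (1 - u m)).
Proof.
move=> hu; elim: N => [|N IH]; first by rewrite !big_ord0 subr0 Normc.normc1.
have := hu N.+1; rewrite !big_ord_recr /= normcMl.
have h1 : 1 - nm (u N) <= nm (1 - u N).
  have := normc_triangle (1 - u N) (u N); rewrite subrK Normc.normc1; lra.
have S0 : 0 <= \sum_(m < N) nm (u m)
    by apply: sumr_ge0 => m _; exact: normc_ge0.
have u0 := normc_ge0 (u N).
move: IH h1 S0 u0; move: (\sum_(m < N) _) (nm (\prod_(_ < _) _)).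
move: (nm (u N)) (nm (1 - u N)) => a b S P h1 h2 h3 h4 h5.
by nra.
Qed.

(** Off finitely many factors the sum of the [nm (u m)] is at most [1/2], so that
    the remaining product is at least [1/2] in modulus. *)
Lemma prod_1B_lower (u : nat -> C) : dominated_sum (fun m => nm (u m)) ->
  (forall m, u m != 1) ->
  exists2 kappa : R, 0 < kappa &
    forall N, kappa <= nm (\prod_(m < N) (1 - u m)).
Proof.
move=> su u1.
have [s0 us0 tail] := dominated_sum_tail (fun m => normc_ge0 (u m)) su
  (divr_gt0 ltr01 (ltr0n _ 2)).
pose M := (\max_(i <- s0) i).+1.
have {tail us0 su} : forall N, \sum_(m < N) nm (u (M + m)%N) <= 1 / 2.
  move=> N; apply: ltW.
  have sub : {subset s0 <= index_iota 0 (M + N)}.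
    move=> i si; rewrite mem_index_iota /= (leq_trans _ (leq_addr N M)) //.
    by rewrite ltnS; exact: leq_bigmax_seq.
  apply: le_lt_trans (tail (index_iota 0 (M + N)) (iota_uniq _ _) sub).
  rewrite (big_cat_nat (n := M)) ?leq_addr //= -[leLHS]add0r.
  apply: lerD; first by apply: sumr_ge0 => i _; exact: normc_ge0.
  rewrite -[M in leRHS]add0n big_addn add0n addKn big_mkord.
  rewrite [leRHS]big_mkcond /=; apply: ler_sum => i _; rewrite addnC; case: ifP => //.
  move/negbFE => si.
  have : (i + M <= \max_(j <- s0) j)%N by exact: leq_bigmax_seq.
  by rewrite -ltnS -/M ltnNge leq_addl.
elim: M u u1 => [|M IH] u u1 hu.
  exists (1 / 2); first by rewrite divr_gt0.
  move=> N; apply: le_trans (prod_1B_ge_half N hu).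
  by have := hu N; rewrite /=; under eq_bigr do rewrite add0n; lra.
have [kappa k0 hk] := IH (fun m => u m.+1) (fun m => u1 m.+1) hu.
have n0 : 0 < nm (1 - u 0) by rewrite normc_gt0 subr_eq0 eq_sym u1.
exists (Num.min 1 (nm (1 - u 0) * kappa)); first by rewrite lt_min ltr01 mulr_gt0.
case=> [|N]; first by rewrite big_ord0 Normc.normc1 ge_min lexx.
rewrite big_ord_recl normcMl ge_min; apply/orP; right.
by rewrite ler_pM2l //; exact: hk.
Qed.

Lemma prod_1B_upper (u : nat -> C) : dominated_sum (fun m => nm (u m)) ->
  exists B : R, forall N, nm (\prod_(m < N) (1 - u m)) <= B.
Proof.
move=> [B hB]; exists (expR B) => N.
apply: (@le_trans _ _ (expR (\sum_(m < N) nm (u m)))).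
  rewrite normc_prod; elim: N => [|N IH]; first by rewrite !big_ord0 expR0.
  rewrite !big_ord_recr /= expRD ler_pM ?normc_ge0 //.
    by apply: prodr_ge0 => i _; exact: normc_ge0.
  apply: le_trans (expR_ge1Dx _); apply: le_trans (normc_triangle _ _) _.
  by rewrite Normc.normc1 normc_opp.
rewrite ler_expR -(big_mkord xpredT (fun m => nm (u m))).
by apply: hB; exact: iota_uniq.
Qed.

Lemma geometric_dominated (c q : C) : nm q < 1 ->
  dominated_sum (fun m => nm (c * q ^+ m)).
Proof.
move=> q1; rewrite (_ : (fun _ => _) = fun m => nm c * nm q ^+ m); last first.
  by apply/funext => m; rewrite normcMl normcX.
apply: dominated_sumZ; first exact: normc_ge0.
apply: (nat_dominated_sum (B := (1 - nm q)^-1)) => [k|N].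
  by rewrite exprn_ge0 // normc_ge0.
rewrite -[leRHS]mul1r ler_pdivlMr ?subr_gt0 //; have := subrX1 (nm q) N.
have : 0 <= nm q ^+ N by rewrite exprn_ge0 // normc_ge0.
move: (nm q ^+ N) (\sum_(_ < _) _) => a S a0 h.
by nra.
Qed.

End ProductBounds.

Lemma cvg_prod (R : realType) (I : Type) (s : seq I) (u : I -> nat -> R[i])
    (L : I -> R[i]) : (forall i, u i @ \oo --> L i) ->
  (fun N => \prod_(i <- s) u i N) @ \oo --> \prod_(i <- s) L i.
Proof.
move=> uL; elim: s => [|i s IH].
  by rewrite big_nil; under eq_fun do rewrite big_nil; exact: cvg_cst.
rewrite big_cons; under eq_fun do rewrite big_cons.
exact: cvgM (uL i) IH.
Qed.

Section TripleProduct.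
Variables (R : realType) (eta : R[i]).
Hypothesis eta_upper : 0 < complex.Im eta.
Local Notation C := R[i].
Local Notation nm := (@Normc.normc R).
Local Notation q := (e eta).
Implicit Types z : C.

Lemma normc_q_lt1 : nm q < 1.
Proof. by rewrite normc_e; case/andP: (nome_lt1 eta_upper). Qed.

Lemma has_sum_finite (I : eqType) (f : I -> C) (s : seq I) : uniq s ->
  (forall i, i \notin s -> f i = 0) -> has_sum f (\sum_(i <- s) f i).
Proof.
move=> us f0 eps e0; exists s => r ur sr.
rewrite (big_subset_split _ us ur sr) addrAC subrr add0r.
by rewrite big1 ?Normc.normc0 // => i /f0.
Qed.

Lemma qfactE N : qfact q N = \prod_(m < N) (1 - q * q ^+ m).
Proof. by apply: eq_bigr => m _; rewrite exprS. Qed.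

Lemma qpow_neq1 m : q ^+ m.+1 != 1.
Proof.
apply/eqP => /(congr1 nm); rewrite normcX Normc.normc1 => h.
have := normc_q_lt1; rewrite ltNge -(@expr_ge1 _ m.+1) ?normc_ge0 //.
by rewrite h lexx.
Qed.

Lemma qfact_neq0 N : qfact q N != 0.
Proof.
apply/prodf_neq0 => m _; rewrite subr_eq0 eq_sym; exact: qpow_neq1.
Qed.

Lemma qfact_bounds : exists2 kappa : R, 0 < kappa & exists2 B : R, 0 < B &
  forall N, kappa <= nm (qfact q N) <= B.
Proof.
have dom := geometric_dominated q normc_q_lt1.
have [|kappa k0 hk] := prod_1B_lower dom.
  by move=> m; rewrite -exprS qpow_neq1.
have [B hB] := prod_1B_upper dom; exists kappa => //.
exists B; last by move=> N; rewrite qfactE hk hB.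
by apply: lt_le_trans k0 (le_trans (hk 0) (hB 0)).
Qed.

(** The increments of [qfact q] are summable, and the lower bound on [qfact q]
    survives in the limit. *)
Lemma qfact_cvg : exists2 phi : C, phi != 0 & qfact q @ \oo --> phi.
Proof.
have [kappa k0 [B B0 hB]] := qfact_bounds.
pose f m := - (q ^+ m.+1 * qfact q m).
have sf : abs_summable f.
  apply: dominated_sum_le
    (dominated_sumZ (ltW B0) (geometric_dominated q normc_q_lt1)) => m.
  rewrite /f normc_opp normcMl mulrC -exprS ler_wpM2r ?normc_ge0 //.
  by case/andP: (hB m).
have [S /has_sum_series hS] := abs_summable_has_sum sf.
have lim : qfact q @ \oo --> 1 + S.
  rewrite (_ : qfact q = fun N => 1 + series f N); first exact: cvgD (cvg_cst _) hS.
  apply/funext => N; rewrite /series /= big_mkord.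
  elim: N => [|N IH]; first by rewrite /qfact !big_ord0 addr0.
  rewrite big_ord_recr /= addrA -IH /qfact big_ord_recr /= -/(qfact q N) /f.
  by ring.
exists (1 + S) => //; rewrite -normc_gt0; apply: lt_le_trans k0 _.
rewrite leNgt; apply/negP => lt; move/cvg_normcP: lim.
rewrite -subr_gt0 in lt; move=> /(_ _ lt)[N _ /(_ N (leqnn N))] /= h.
have := normc_triangle (qfact q N - (1 + S)) (1 + S).
rewrite subrK; case/andP: (hB N) => h2 _; move: h h2.
by move: (nm _) (nm _) (nm _) => *; lra.
Qed.

(** The partial products of the triple product, apart from [qfact]. *)
Definition triple_prod z N : C :=
  \prod_(m < N) (1 - e z * q ^+ m) * \prod_(m < N) (1 - e (- z) * q * q ^+ m).

(** The q-binomial theorem with [2 N] factors. Shifting [y] by [q ^- N] centres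
    the factors, and pulling the monomial [c] out turns those of negative index
    into factors in [e (- z)]. *)
Lemma triple_prod_expand z N : triple_prod z N =
  \sum_(k < (N + N).+1)
     qbin q (N + N) k * gauss_term eta (z + 2^-1) (k%:Z - N%:Z).
Proof.
pose w := z + 2^-1; pose c := e (N%:R * w - N%:R * (N%:R + 1) / 2 * eta).
apply: (mulfI (e_neq0 (N%:R * w - N%:R * (N%:R + 1) / 2 * eta))).
rewrite -/c; pose y := e (w - N%:R * eta).
have yE : y = - e (z - N%:R * eta).
  rewrite /y (_ : w - _ = z - N%:R * eta + 2^-1); last by rewrite /w addrAC.
  by rewrite [LHS]eD e_half mulrN1.
transitivity (\prod_(m < N + N) (1 + y * q ^+ m)); last first.
  rewrite qbinomial_theorem mulr_sumr; apply: eq_bigr => k _.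
  rewrite mulrAC mulrCA mulrC; congr (_ * _).
  rewrite -!e_natl /c /gauss_term -!eD; congr e.
  have -> : 'C(k, 2)%:R = k%:R * (k%:R - 1) / 2 :> C.
    have := triE k; rewrite /tri => /(congr1 (fun m : int => m%:~R : C)).
    rewrite !rmorphM /= rmorphB /= -!pmulrn => <-.
    by rewrite mulfK // pnatr_eq0.
  by rewrite -/w; field.
rewrite big_split_ord /= mulrCA mulrC; congr (_ * _); last first.
  apply: eq_bigr => m _.
  by rewrite exprD mulrA yE mulNr -[q ^+ N]e_natl -eD subrK mulNr.
rewrite [RHS](reindex_inj rev_ord_inj) /=.
have -> : c = \prod_(m < N) (- e (z - m.+1%:R * eta)).
  rewrite /c; elim: (N) => [|k IH].
    by rewrite big_ord0 !mul0r subrr e0.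
  rewrite big_ord_recr /= -IH -[- e _]mulrN1 -e_half -!eD; congr e.
  by rewrite /w -natr1; field.
rewrite -big_split /=; apply: eq_bigr => m _.
have -> : y * q ^+ (N - m.+1) = - e (z - m.+1%:R * eta).
  rewrite yE mulNr -e_natl -eD natrB ?ltn_ord //; congr (- e _).
  by ring.
have -> : e (- z) * q * q ^+ m = (e (z - m.+1%:R * eta))^-1.
  by rewrite -eN -mulrA -exprS -e_natl -eD; congr e; ring.
by rewrite mulrBr mulr1 mulNr mulfV ?e_neq0 // opprK addrC.
Qed.

Definition triple_coef N (l : int) : C :=
  if (`|l| <= N)%N then qfact q N * qbin q (N + N) (absz (N%:Z + l)) else 0.

Lemma has_sum_triple z N :
  has_sum (fun l => triple_coef N l * gauss_term eta (z + 2^-1) l)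
    (qfact q N * triple_prod z N).
Proof.
rewrite triple_prod_expand mulr_sumr.
pose s := [seq k%:Z - N%:Z | k <- iota 0 (N + N).+1].
have us : uniq s by rewrite map_inj_uniq ?iota_uniq // => i j; lia.
pose f l := triple_coef N l * gauss_term eta (z + 2^-1) l.
have fs l : l \notin s -> f l = 0.
  move=> ls; rewrite /f /triple_coef; case: leqP; rewrite ?mul0r // => lN.
  case/negP: ls; apply/mapP; exists (absz (l + N%:Z)); last by lia.
  by rewrite mem_iota; lia.
have := has_sum_finite us fs; rewrite /f /s big_map.
rewrite -[iota 0 _]/(index_iota 0 (N + N).+1) big_mkord.
congr has_sum; apply: eq_bigr => k _; rewrite mulrA; congr (_ * _).
rewrite /triple_coef ifT; last by have := ltn_ord k; lia.
by congr (_ * qbin _ _ _); lia.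
Qed.

(** The form of the coefficients in which the limit and the uniform bound are
    visible. *)
Lemma triple_coefE N l : (`|l| <= N)%N -> triple_coef N l
  = qfact q N * qfact q (N + N)
    / (qfact q (absz (N%:Z + l)) * qfact q (absz (N%:Z - l))).
Proof.
move=> lN; rewrite /triple_coef lN.
have a : (absz (N%:Z + l)%R <= N + N)%N by lia.
have b : (N + N - absz (N%:Z + l)%R = absz (N%:Z - l)%R)%N by lia.
have := qbin_fact q a; rewrite b => <-.
by field; rewrite !qfact_neq0.
Qed.

Lemma triple_coef_bound : exists2 K : R, 0 < K &
  forall N l, nm (triple_coef N l) <= K.
Proof.
have [kappa k0 [B B0 hB]] := qfact_bounds.
exists (B * B / (kappa * kappa)); first by rewrite divr_gt0 ?mulr_gt0.
move=> N l; have [lN|lN] := leqP `|l|%N N; last first.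
  by rewrite /triple_coef leqNgt lN Normc.normc0 divr_ge0 ?mulr_ge0 ?ltW.
rewrite triple_coefE // !normcMl Normc.normcV normcMl.
have u M : nm (qfact q M) <= B by case/andP: (hB M).
have d M : kappa <= nm (qfact q M) by case/andP: (hB M).
apply: ler_pM; rewrite ?mulr_ge0 ?invr_ge0 ?mulr_ge0 ?normc_ge0 //.
  by apply: ler_pM; rewrite ?normc_ge0.
have p M : 0 < nm (qfact q M) := lt_le_trans k0 (d M).
by rewrite lef_pV2 ?posrE ?mulr_gt0 //; apply: ler_pM; rewrite ?(ltW k0).
Qed.

Lemma cvg_subsequence (u : nat -> C) (L : C) (k : nat -> nat) (d : nat) :
  u @ \oo --> L -> (forall N, (N <= k N + d)%N) -> (fun N => u (k N)) @ \oo --> L.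
Proof.
move=> /cvg_normcP uL hk; apply/cvg_normcP => eps /uL[M _ hM].
exists (M + d)%N => // N /= hN; apply: hM => /=.
by have := hk N; lia.
Qed.

Lemma triple_coef_cvg l : triple_coef ^~ l @ \oo --> (1 : C).
Proof.
have [phi phi0 hphi] := qfact_cvg.
have c1 : (fun N => qfact q (N + N)) @ \oo --> phi.
  by apply: (cvg_subsequence (d := 0) hphi) => N; lia.
have c2 : (fun N => qfact q (absz (N%:Z + l))) @ \oo --> phi.
  by apply: (cvg_subsequence (d := `|l|%N) hphi) => N; lia.
have c3 : (fun N => qfact q (absz (N%:Z - l))) @ \oo --> phi.
  by apply: (cvg_subsequence (d := `|l|%N) hphi) => N; lia.
have phi2 : phi * phi != 0 by rewrite mulf_neq0.
have lim : (fun N => qfact q N * qfact q (N + N)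
    / (qfact q (absz (N%:Z + l)) * qfact q (absz (N%:Z - l)))) @ \oo
    --> phi * phi / (phi * phi).
  exact: cvgM (cvgM hphi c1) (cvgV phi2 (cvgM c2 c3)).
rewrite (mulfV phi2) in lim; have {}lim := cvg_normc_lt _ lim.
apply/cvg_normcP => eps /lim[M _ hM]; exists (maxn M (absz l)) => // N /=.
by rewrite geq_max => /andP[/hM /= h lN]; rewrite triple_coefE.
Qed.

(** The coefficients of the finite expansion are bounded and tend to [1], so that
    dominated convergence applies. *)
Lemma jacobi_triple_product z :
  (fun N => qfact q N * triple_prod z N) @ \oo --> theta eta z.
Proof.
have [K K0 hK] := triple_coef_bound.
pose w := z + 2^-1.
have K1 : 0 <= K + 1 by rewrite addr_ge0 // ltW.
pose g m := (K + 1) * 1 ^+ `|m|%N * (nome eta ^+ tri m * growth w ^+ `|m|%N).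
have sg : dominated_sum g by apply: gauss_term_dominated.
have g0 m : 0 <= g m by rewrite !mulr_ge0 ?exprn_ge0 ?expR_ge0.
apply: (dominated_has_sum_cvg (F := \oo)
  (f := fun N l => triple_coef N l * gauss_term eta w l)
  (l := gauss_term eta w) (g := g)) => //.
- exists 0 => // N _; split; first exact: has_sum_triple.
  move=> m; rewrite normcMl /g expr1n mulr1; apply: ler_pM.
  + exact: normc_ge0.
  + exact: normc_ge0.
  + by apply: le_trans (hK _ _) _; rewrite lerDl.
  + exact: gauss_term_norm.
- move=> m; apply: le_trans (gauss_term_norm _ _ _) _.
  rewrite /g expr1n mulr1 -[leLHS]mul1r ler_wpM2r ?lerDr ?(ltW K0) //.
  by rewrite mulr_ge0 ?exprn_ge0 ?expR_ge0.
- exact: has_sum_theta.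
- move=> m; rewrite -[X in _ --> X]mul1r.
  exact: cvgM (triple_coef_cvg m) (cvg_cst _).
Qed.

Lemma lattice_e z (m : nat) : (e z * q ^+ m = 1 \/ e (- z) * q ^+ m = 1) ->
  lattice eta z.
Proof.
rewrite -e_natl -!eD => -[] /e_eq1[a ha].
  exists a, (- m%:Z); rewrite -ha rmorphN /= -pmulrn; ring.
by exists (- a), m%:Z; rewrite rmorphN /= -ha -pmulrn; ring.
Qed.

(** The partial products stay away from [0], as none of their factors vanishes. *)
Lemma theta_neq0 z : ~ lattice eta z -> theta eta z != 0.
Proof.
move=> zL.
have n1 m : e z * q ^+ m != 1.
  by apply/eqP => h; apply: zL; apply: (@lattice_e z m); left.
have n2 m : e (- z) * q * q ^+ m != 1.
  apply/eqP => h; apply: zL; apply: (@lattice_e z m.+1); right.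
  by rewrite exprS mulrA.
have [k1 k10 h1] := prod_1B_lower (geometric_dominated _ normc_q_lt1) n1.
have [k2 k20 h2] := prod_1B_lower (geometric_dominated _ normc_q_lt1) n2.
have [k3 k30 [B B0 h3]] := qfact_bounds.
pose k := k3 * (k1 * k2).
have k0 : 0 < k by rewrite !mulr_gt0.
apply/eqP => t0; have := @jacobi_triple_product z; rewrite t0.
move=> /cvg_normcP/(_ _ k0)[N _ /(_ N (leqnn N))] /=.
rewrite subr0 ltNge => /negP; apply; rewrite !normcMl.
apply: ler_pM; rewrite ?mulr_ge0 ?(ltW k10) ?(ltW k20) ?(ltW k30) //.
  by case/andP: (h3 N).
by apply: ler_pM; rewrite ?(ltW k10) ?(ltW k20).
Qed.

End TripleProduct.

Section ThetaZeros.
Variables (R : realType).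
Local Notation C := R[i].
Implicit Types eta z : C.

Lemma theta0 eta : 0 < complex.Im eta -> theta eta 0 = 0.
Proof.
move=> eta_upper; have := theta_opp eta_upper 0.
rewrite oppr0 e0 mulN1r => /eqP; rewrite -subr_eq0 opprK -mulr2n mulrn_eq0.
by move/eqP.
Qed.

Lemma theta_int eta z (a : int) : 0 < complex.Im eta ->
  theta eta (z + a%:~R) = theta eta z.
Proof.
move=> eta_upper; have nat_case z0 (k : nat) : theta eta (z0 + k%:R) = theta eta z0.
  elim: k => [|k IH]; first by rewrite addr0.
  by rewrite -natr1 addrA thetaD1.
case: a => k; first by rewrite -pmulrn nat_case.
by rewrite NegzE mulrNz -pmulrn -(nat_case _ k.+1) subrK.
Qed.

(** Only the fact that the factor of quasi-periodicity is a unit matters for the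
    zeros. *)
Lemma theta_lattice_unit eta z (b : int) : 0 < complex.Im eta ->
  exists2 c : C, c != 0 & theta eta (z + b%:~R * eta) = c * theta eta z.
Proof.
move=> eta_upper.
have nat_case z0 (k : nat) :
    exists2 c : C, c != 0 & theta eta (z0 + k%:R * eta) = c * theta eta z0.
  elim: k => [|k [c c0 hc]].
    by exists 1; rewrite ?oner_eq0 // mul0r addr0 mul1r.
  exists (- e (- (z0 + k%:R * eta)) * c).
    by rewrite mulf_neq0 // oppr_eq0 e_neq0.
  by rewrite -natr1 mulrDl mul1r addrA theta_eta // hc mulrA.
case: b => k; first by rewrite -pmulrn.
have [c c0 hc] := nat_case (z + (Negz k)%:~R * eta) k.+1.
exists c^-1; first by rewrite invr_eq0.
move: hc; rewrite NegzE mulrNz -pmulrn mulNr subrK => ->.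
by rewrite mulKf.
Qed.

Lemma theta_eq0 eta z : 0 < complex.Im eta ->
  theta eta z = 0 <-> lattice eta z.
Proof.
move=> eta_upper; split=> [z0|[a [b ->]]].
  by apply: contrapT => /(theta_neq0 eta_upper)/eqP.
have [c _] := theta_lattice_unit a%:~R b eta_upper.
by rewrite -[a%:~R]add0r theta_int // theta0 // mulr0.
Qed.

End ThetaZeros.

Lemma prod_1B_unity_roots (F : fieldType) (n : nat) (z : F) (y : F) :
  n.-primitive_root z -> \prod_(m < n) (1 - y * z ^+ m) = 1 - y ^+ n.
Proof.
move=> zn; have n0 := prim_order_gt0 zn; have [->|y0] := eqVneq y 0.
  rewrite expr0n gtn_eqF //= subr0 big1 // => m _.
  by rewrite mul0r subr0.
have /(congr1 (fun p => p.[y^-1])) := factor_Xn_sub_1 zn.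
rewrite horner_prod !hornerE => h.
have -> : 1 - y ^+ n = y ^+ n * (y^-1 ^+ n - 1).
  by rewrite mulrBr mulr1 -exprMn mulfV // expr1n.
rewrite -h big_mkord -[y ^+ n](_ : \prod_(m < n) y = _); last first.
  by rewrite prodr_const card_ord.
rewrite -big_split /=; apply: eq_bigr => m _.
by rewrite !hornerE mulrBr mulfV.
Qed.

Section ThetaMultiplication.
Variables (R : realType) (eta : R[i]) (n : nat).
Hypothesis eta_upper : 0 < complex.Im eta.
Hypothesis n_gt0 : (0 < n)%N.
Local Notation C := R[i].
Implicit Types z : C.

Lemma nC_neq0 : n%:R != 0 :> C.
Proof. by rewrite pnatr_eq0 -lt0n. Qed.

Lemma Im_natM (m : nat) (a : C) : complex.Im (m%:R * a) = m%:R * complex.Im a.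
Proof. by rewrite pmulrn Im_intM -pmulrn. Qed.

Lemma neta_upper : 0 < complex.Im (n%:R * eta).
Proof. by rewrite Im_natM mulr_gt0 // ltr0n. Qed.

Lemma e_inv_prim : n.-primitive_root (e n%:R^-1 : C).
Proof.
apply/andP; split => //; apply/forallP => i.
rewrite unity_rootE -e_natl; apply/eqP; apply/eqP/eqP => [/e_eq1[m hm]|->]; last first.
  by rewrite mulfV ?nC_neq0 // e1.
have : i.+1%:Z = m * n%:Z.
  have : i.+1%:R = m%:~R * n%:R :> C by rewrite -hm divfK ?nC_neq0.
  by rewrite !pmulrn -intrM => /eqP; rewrite eqr_int => /eqP.
have := ltn_ord i => iln mn.
have [m0|[m1|m2]] : m <= 0 \/ m = 1 \/ 2 <= m by lia.
- by exfalso; nia.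
- by move: mn; rewrite m1; lia.
- by exfalso; nia.
Qed.

Lemma prod_1B_roots (y : C) :
  \prod_(m < n) (1 - y * e (m%:R / n%:R)) = 1 - y ^+ n.
Proof.
rewrite -(prod_1B_unity_roots y e_inv_prim); apply: eq_bigr => m _.
by rewrite -e_natl.
Qed.

Lemma prod_1B_roots_inv (y : C) :
  \prod_(m < n) (1 - y * e (- (m%:R / n%:R))) = 1 - y ^+ n.
Proof.
have -> : y ^+ n = (y * e n%:R^-1) ^+ n.
  by rewrite exprMn -[e _ ^+ n]e_natl mulfV ?nC_neq0 // e1 mulr1.
rewrite -prod_1B_roots (reindex_inj rev_ord_inj) /=.
apply: eq_bigr => m _; congr (1 - _); rewrite -mulrA; congr (_ * _).
rewrite -[LHS]mulr1 -[X in _ * X = _]e1 -!eD; congr e; rewrite natrB ?ltn_ord //.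
by have := nC_neq0; move: (n%:R) => N N0; field.
Qed.

(** Since [1 - y^n] factors over the [n]-th roots of unity, the product of the
    translates of [theta] by [m / n] is [theta] at [n z] for [n eta]. *)
Lemma theta_multiplication : exists2 c : C, c != 0 & forall z,
  \prod_(m < n) theta eta (z + m%:R / n%:R) = c * theta (n%:R * eta) (n%:R * z).
Proof.
have [phi phi0 hphi] := qfact_cvg eta_upper.
have [psi psi0 hpsi] := qfact_cvg neta_upper.
exists (phi ^+ n / psi); first by rewrite mulf_neq0 ?expf_neq0 ?invr_eq0.
move=> z.
have lim1 := cvg_prod (s := index_enum 'I_n)
  (fun m : 'I_n => @jacobi_triple_product _ _ eta_upper (z + m%:R / n%:R)).
have lim2 : (fun N => (\prod_(m < n) qfact (e eta) N)
    * (qfact (e (n%:R * eta)) N)^-1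
    * (qfact (e (n%:R * eta)) N * triple_prod (n%:R * eta) (n%:R * z) N)) @ \oo
    --> phi ^+ n / psi * theta (n%:R * eta) (n%:R * z).
  rewrite -[n in _ ^+ n]card_ord -prodr_const.
  exact: cvgM (cvgM (cvg_prod (s := index_enum 'I_n) (fun=> hphi))
    (cvgV psi0 hpsi)) (@jacobi_triple_product _ _ neta_upper (n%:R * z)).
apply: (cvg_unique (@norm_hausdorff _ _) lim1).
rewrite (_ : (fun N => _) = (fun N => (\prod_(m < n) qfact (e eta) N)
    * (qfact (e (n%:R * eta)) N)^-1
    * (qfact (e (n%:R * eta)) N * triple_prod (n%:R * eta) (n%:R * z) N)));
  first exact: lim2.
apply/funext => N.
rewrite -mulrA (mulKf (qfact_neq0 neta_upper N)).
rewrite big_split /=; congr (_ * _).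
rewrite /triple_prod big_split /=; congr (_ * _);
  rewrite exchange_big /=; apply: eq_bigr => m _.
- rewrite e_natl [e (n%:R * eta)]e_natl exprAC -exprMn -prod_1B_roots.
  by apply: eq_bigr => i _; rewrite eD mulrAC.
- rewrite -[- (n%:R * z)]mulrN !e_natl exprAC.
  rewrite -!exprMn.
  rewrite -prod_1B_roots_inv.
  by apply: eq_bigr => i _; rewrite opprD eD; congr (1 - _); ring.
Qed.

End ThetaMultiplication.

(** * The theta functions of level [n] *)

Section LockedExponential.
Variable R : realType.
Implicit Types z w : R[i].

(** [e] under a lock: it unfolds to a product, and the search for products to
    rewrite would otherwise look inside it. *)
Definition expi : R[i] -> R[i] := locked (@e R).

Lemma expiE z : e z = expi z. Proof. by rewrite /expi -lock. Qed.

Lemma expiD z w : expi (z + w) = expi z * expi w.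
Proof. by rewrite -!expiE eD. Qed.

Lemma expi_neq0 z : expi z != 0. Proof. by rewrite -expiE e_neq0. Qed.

Lemma expi_int (m : int) : expi m%:~R = 1. Proof. by rewrite -expiE e_int. Qed.

Lemma expi1 : expi 1 = 1. Proof. by rewrite -expiE e1. Qed.

Lemma expi_half : expi 2^-1 = -1. Proof. by rewrite -expiE e_half. Qed.

End LockedExponential.

Section LevelTheta.
Variables (R : realType) (eta : R[i]) (n : nat).
Hypothesis eta_upper : 0 < complex.Im eta.
Hypothesis n_gt0 : (0 < n)%N.
Local Notation C := R[i].
Local Notation neta := (n%:R * eta).
Local Notation psi := (theta neta).
Local Notation th := (theta_ n eta).
Implicit Types (z : C) (alpha : int).

Let n0 : n%:R != 0 :> C := nC_neq0 R n_gt0.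
Let neta_up : 0 < complex.Im neta := neta_upper eta_upper n_gt0.

Lemma theta_levelE : exists2 c : C, c != 0 & forall alpha z, th alpha z =
  c * expi (alpha%:~R * z + alpha%:~R / (2 * n%:R)
         + (alpha * (alpha - n%:Z))%:~R / (2 * n%:R) * eta)
    * psi (n%:R * z + alpha%:~R * eta).
Proof.
have [c c0 hc] := theta_multiplication eta_upper n_gt0.
exists c => // alpha z; rewrite /theta_ expiE -[RHS]mulrA [RHS]mulrCA.
congr (_ * _).
have -> : n%:R * z + alpha%:~R * eta = n%:R * (z + alpha%:~R / n%:R * eta).
  by have := n0; move: (n%:R) => N N0; field.
by rewrite -hc; apply: eq_bigr => m _; rewrite addrAC.
Qed.

Lemma theta_level_modn alpha z (b : int) : th (alpha + b * n%:Z) z = th alpha z.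
Proof.
have [c c0 hc] := theta_levelE.
have step al : th (al + n%:Z) z = th al z.
  rewrite !hc.
  have -> : n%:R * z + (al + n%:Z)%:~R * eta
      = n%:R * z + al%:~R * eta + neta.
    by rewrite rmorphD /= -pmulrn; ring.
  rewrite theta_eta // !expiE !mulrA; congr (_ * _); rewrite -!mulrA; congr (_ * _).
  rewrite -[- expi _]mulN1r -expi_half -!expiD -[RHS]mulr1.
  rewrite -[X in _ = _ * X]expi1 -expiD; congr expi.
  rewrite !(rmorphM, rmorphB, rmorphD) /= -[n%:~R]pmulrn.
  by have := n0; move: (n%:R) => N N0; field.
have nat_case al (k : nat) : th (al + k%:Z * n%:Z) z = th al z.
  elim: k => [|k IH]; first by rewrite mul0r addr0.
  by rewrite -addn1 PoszD mulrDl mul1r addrA step.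
case: b => k; first exact: nat_case.
rewrite -[LHS](nat_case _ k.+1) NegzE; congr (th _ z); ring.
Qed.

Lemma theta_level_opp alpha z :
  th alpha (- z) = - expi (- (n%:R * z) + alpha%:~R / n%:R) * th (- alpha) z.
Proof.
have [c c0 hc] := theta_levelE; rewrite !hc.
have -> : n%:R * - z + alpha%:~R * eta = - (n%:R * z + (- alpha)%:~R * eta).
  by rewrite rmorphN /=; ring.
rewrite theta_opp // !expiE !mulrA; congr (_ * _).
rewrite ![_ * c]mulrC -!mulrA; congr (_ * _).
rewrite !mulNr mulrN -!expiD; congr (- expi _).
rewrite !(rmorphM, rmorphB, rmorphD, rmorphN) /= -[n%:~R]pmulrn.
by have := n0; move: (n%:R) => N N0; field.
Qed.

(** The zeros of the theta function for [n eta], moved by [theta_levelE]. *)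
Lemma theta_level_eq0 alpha z :
  th alpha z = 0 <-> lattice neta (n%:R * z + alpha%:~R * eta).
Proof.
have [c c0 hc] := theta_levelE; rewrite hc -theta_eq0 //; split => [/eqP|->].
  by rewrite !mulf_eq0 (negPf c0) (negPf (expi_neq0 _)) => /eqP.
by rewrite mulr0.
Qed.

Lemma lattice_coords (p l : int) :
  lattice neta (p%:~R + l%:~R * eta) <-> (n%:Z %| l)%Z.
Proof.
split=> [[a [b]]|/dvdzP[b ->]].
  have -> : a%:~R + b%:~R * neta = a%:~R + (b * n%:Z)%:~R * eta.
    by rewrite rmorphM /= -[n%:~R]pmulrn mulrA.
  move=> /(congr1 (@complex.Im R)); rewrite !ImD !Im_intM.
  have Imint (m : int) : complex.Im (m%:~R : C) = 0.
    by rewrite -(rmorph_int (real_complex R)).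
  rewrite !Imint !add0r => /(mulIf (lt0r_neq0 eta_upper)).
  by move=> /eqP; rewrite eqr_int => /eqP ->; rewrite dvdz_mull.
by exists p, b; rewrite rmorphM /= -[n%:~R]pmulrn mulrA.
Qed.

Lemma theta_level0_eq0 alpha : th alpha 0 = 0 <-> (n%:Z %| alpha)%Z.
Proof.
by rewrite theta_level_eq0 mulr0 -(lattice_coords 0 alpha).
Qed.

Lemma theta_level_neq0 alpha z : ~ torsion_lattice n eta z -> th alpha z != 0.
Proof.
move=> zT; apply/eqP => /theta_level_eq0[a [b h]]; apply: zT.
exists a, (b * n%:Z - alpha); move: h => /(canRL (addrK _)) ->.
by rewrite rmorphB rmorphM /= -[n%:~R]pmulrn; ring.
Qed.

(** At a torsion point the vanishing of [theta_alpha] is a congruence on [alpha]. *)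
Lemma theta_level_torsion alpha z (p l : int) :
  n%:R * z = p%:~R + l%:~R * eta ->
  th alpha z = 0 <-> (n%:Z %| l + alpha)%Z.
Proof.
by move=> zE; rewrite theta_level_eq0 zE -addrA -mulrDl -rmorphD lattice_coords.
Qed.

(** The factor does not depend on [alpha]: this makes the line generated by a
    vector of products, of equal length, of such functions periodic. *)
Lemma theta_level_shift z (l : C) : lattice eta l ->
  exists2 u : C, u != 0 & forall alpha, th alpha (z + l) = u * th alpha z.
Proof.
have [c c0 hc] := theta_levelE.
have int_case z0 (a : int) alpha : th alpha (z0 + a%:~R) = th alpha z0.
  rewrite !hc.
  have -> : n%:R * (z0 + a%:~R) + alpha%:~R * eta
      = n%:R * z0 + alpha%:~R * eta + (n%:Z * a)%:~R.
    by rewrite rmorphM /= -[n%:~R]pmulrn; ring.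
  rewrite theta_int //; congr (_ * _ * _).
  have -> : alpha%:~R * (z0 + a%:~R) = alpha%:~R * z0 + (alpha * a)%:~R :> C.
    by rewrite rmorphM /=; ring.
  by rewrite -[_ + _ + alpha%:~R / _]addrA [_ + (_ + alpha%:~R / _)]addrCA
     -[_ + _ + _ * eta]addrA expiD expi_int mul1r.
have step z0 alpha : th alpha (z0 + eta) = - expi (- (n%:R * z0)) * th alpha z0.
  rewrite !hc.
  have -> : n%:R * (z0 + eta) + alpha%:~R * eta
      = n%:R * z0 + alpha%:~R * eta + neta by ring.
  rewrite theta_eta // !expiE !mulrA; congr (_ * _).
  rewrite ![_ * c]mulrC -!mulrA; congr (_ * _).
  by rewrite !mulNr mulrN -!expiD; congr (- expi _); ring.
have nat_case (k : nat) z0 : exists2 u : C, u != 0 &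
    forall alpha, th alpha (z0 + k%:R * eta) = u * th alpha z0.
  elim: k => [|k [u u0 hu]].
    by exists 1; rewrite ?oner_eq0 // => al; rewrite mul0r addr0 mul1r.
  exists (- expi (- (n%:R * (z0 + k%:R * eta))) * u).
    by rewrite mulf_neq0 // oppr_eq0 expi_neq0.
  by move=> al; rewrite -natr1 mulrDl mul1r addrA step hu mulrA.
move=> [a [b ->]]; case: b => k.
  have [u u0 hu] := nat_case k z; exists u => // al.
  by rewrite addrA addrAC -pmulrn int_case hu.
have [u u0 hu] := nat_case k.+1 (z + (Negz k)%:~R * eta).
exists u^-1 => [|al]; first by rewrite invr_eq0.
rewrite addrA addrAC int_case.
have := hu al; rewrite NegzE mulrNz -pmulrn mulNr subrK => ->.
by rewrite mulKf.
Qed.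

Lemma theta_level_derivable alpha z : derivable (th alpha) z 1.
Proof.
have [c c0 hc] := theta_levelE.
pose b := alpha%:~R / (2 * n%:R)
  + (alpha * (alpha - n%:Z))%:~R / (2 * n%:R) * eta.
have -> : th alpha = fun w => c * (expi (alpha%:~R * w + b)
    * psi (n%:R * w + alpha%:~R * eta)).
  by apply/funext => w; rewrite hc /b addrA mulrA.
have [d hd] := theta_cderiv neta_up (n%:R * z + alpha%:~R * eta).
apply: derivableM; first exact: derivable_cst.
apply: derivableM.
  have := has_cderiv_derivable (e_cderiv alpha%:~R b z).
  by under eq_fun do rewrite expiE.
exact: has_cderiv_derivable (has_cderiv_affine hd).
Qed.

(** In the variables [x = n z + (m / 2 - j) eta] and [y = (a - m / 2) eta],
    the product of the theta functions of indices [a - j] and [m - a - j] is a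
    two-by-two determinant, up to factors of [j] alone and of [a] alone. *)
Lemma theta_level_pair z (m : int) : exists A B : C -> C,
  (forall x y, psi (x + y) * psi (x - y) = expi x * (A x * B y - B x * A y)) /\
  exists u v : int -> C, (forall j, u j != 0) /\ (forall a, v a != 0) /\
  forall a j, th (a - j) z * th (m - a - j) z = u j * v a
    * (A (n%:R * z + (m%:~R / 2 - j%:~R) * eta) * B ((a%:~R - m%:~R / 2) * eta)
     - B (n%:R * z + (m%:~R / 2 - j%:~R) * eta) * A ((a%:~R - m%:~R / 2) * eta)).
Proof.
have [c c0 hc] := theta_levelE.
have [A [B hE]] := theta_three_term neta_up.
have hAB x y : psi (x + y) * psi (x - y) = expi x * (A x * B y - B x * A y).
  by rewrite hE expiE.
exists A, B; split => //.
pose x j := n%:R * z + (m%:~R / 2 - j%:~R) * eta.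
pose f j := (m%:~R - 2 * j%:~R) * (z + (2 * n%:R)^-1 - eta / 2)
  + (m%:~R / 2 - j%:~R) ^+ 2 / n%:R * eta.
exists (fun j => c * c * expi (f j) * expi (x j)).
exists (fun a => expi ((a%:~R - m%:~R / 2) ^+ 2 / n%:R * eta)).
split; first by move=> j; rewrite !mulf_neq0 // expi_neq0.
split; first by move=> a; exact: expi_neq0.
move=> a j; rewrite !hc -/(x j).
set y := (a%:~R - m%:~R / 2) * eta.
have -> : n%:R * z + (a - j)%:~R * eta = x j + y.
  by rewrite /x /y !rmorphB /=; field.
have -> : n%:R * z + (m - a - j)%:~R * eta = x j - y.
  by rewrite /x /y !rmorphB /=; field.
rewrite mulrACA hAB !mulrA; congr (_ * _).
rewrite [in RHS]mulrAC; congr (_ * _).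
rewrite [_ * expi _ * c]mulrAC -[LHS]mulrA -[RHS]mulrA -!expiD.
congr (_ * expi _); rewrite /f !(rmorphM, rmorphB, rmorphD) /= -[n%:~R]pmulrn.
by have := n0; move: (n%:R) => N N0; field.
Qed.

End LevelTheta.

(** * A Cauchy-matrix argument *)

Section CauchySpan.
Variables (F : fieldType) (V : vectType F).

Definition det2 (p q : F * F) : F := p.1 * q.2 - p.2 * q.1.

(** Gaussian elimination on the Cauchy matrix [1 / det2 p q]: by the Pluecker
    relation, clearing the first column turns it into a Cauchy matrix again, up
    to scaling of the rows and of the columns. *)
Lemma cauchy_span (J : eqType) (q : J -> F * F) (S : {vspace V})
    (ps : seq (F * F)) (qs : seq J) (w : J -> V) :
  (size qs <= size ps)%N ->
  pairwise (fun p p' => det2 p p' != 0) ps ->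
  pairwise (fun a b => det2 (q a) (q b) != 0) qs ->
  (forall p a, p \in ps -> a \in qs -> det2 p (q a) != 0) ->
  (forall p, p \in ps -> \sum_(a <- qs) (det2 p (q a))^-1 *: w a \in S) ->
  forall a, a \in qs -> w a \in S.
Proof.
elim: qs ps w => [|a0 qs IH] [|p0 ps] // w.
rewrite [size _]/= [size _]/= ltnS => sz; rewrite pairwise_cons.
move=> /andP[/allP p0ps pps]; rewrite pairwise_cons => /andP[/allP a0qs aqs].
move=> pq RS.
pose c a := det2 (q a0) (q a) / det2 p0 (q a).
have p0q a : a \in a0 :: qs -> det2 p0 (q a) != 0.
  by apply: pq; rewrite mem_head.
have R0 := RS p0 (mem_head _ _).
have wqs a : a \in qs -> w a \in S.
  move=> aq; have ca0 : c a != 0.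
    by rewrite mulf_neq0 ?a0qs // invr_eq0 p0q // inE aq orbT.
  suff : c a *: w a \in S by rewrite rpredZeq (negPf ca0).
  apply: (IH ps (fun a => c a *: w a)) => // [p b pp bq|p pp].
    by apply: pq; rewrite inE ?pp ?bq orbT.
  have Rp : \sum_(a <- a0 :: qs) (det2 p (q a))^-1 *: w a \in S.
    by apply: RS; rewrite inE pp orbT.
  have pn0 b : b \in a0 :: qs -> det2 p (q b) != 0.
    by move=> bq; apply: pq; rewrite // inE pp orbT.
  suff -> : \sum_(b <- qs) (det2 p (q b))^-1 *: (c b *: w b)
    = (det2 p0 p)^-1 *:
        (det2 p0 (q a0) *: (\sum_(a <- a0 :: qs) (det2 p0 (q a))^-1 *: w a)
       - det2 p (q a0) *: (\sum_(a <- a0 :: qs) (det2 p (q a))^-1 *: w a)).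
    by rewrite rpredZ // rpredB // rpredZ.
  have clear_head (x : F) v : x != 0 -> x *: (x^-1 *: w a0 + v) = w a0 + x *: v.
    by move=> x0; rewrite scalerDr scalerA mulfV // scale1r.
  rewrite !big_cons !clear_head ?p0q ?pn0 ?mem_head //.
  rewrite opprD addrACA subrr add0r !scaler_sumr -sumrB scaler_sumr.
  apply: eq_big_seq => b bq; rewrite !scalerA -scalerBl scalerA; congr (_ *: _).
  have := p0ps _ pp; have := p0q b; have := pn0 b.
  rewrite inE bq orbT => /(_ isT) h1 /(_ isT) h2 h3.
  by move: h1 h2 h3; rewrite /c /det2; move=> h1 h2 h3; field; rewrite h1 h2.
move=> a; rewrite inE => /predU1P[->|/wqs //].
move: R0; rewrite big_cons rpredDr; last first.
  by rewrite big_seq; apply: rpred_sum => b /wqs bS; rewrite rpredZ.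
by rewrite rpredZeq invr_eq0 (negPf (p0q _ (mem_head _ _))).
Qed.

End CauchySpan.

(** * Theta functions indexed by residues *)

Section Residues.
Variable n : nat.
Hypothesis n_gt1 : (1 < n)%N.

Lemma Zp_intr_eq0 (a : int) : (a%:~R == 0 :> 'Z_n) = (n%:Z %| a)%Z.
Proof.
have natE (k : nat) : (k%:R == 0 :> 'Z_n) = (n %| k)%N.
  by rewrite -val_eqE /= [X in X == _](val_Zp_nat n_gt1).
rewrite dvdzE /=; case: a => k; first by rewrite -pmulrn natE.
by rewrite NegzE mulrNz oppr_eq0 -pmulrn natE abszN.
Qed.

Lemma Zp_intrK (a : 'Z_n) : a%:Z%:~R = a.
Proof. by rewrite -pmulrn natr_Zp. Qed.

Lemma Zp_intr_eq (a b : int) :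
  a%:~R = b%:~R :> 'Z_n -> exists c, a = b + c * n%:Z.
Proof.
move=> /eqP; rewrite -subr_eq0 -rmorphB Zp_intr_eq0 => /dvdzP[c h].
by exists c; rewrite -h addrC subrK.
Qed.

Lemma Zp_pred_natr : (n - 1)%:Z%:~R = -1 :> 'Z_n.
Proof.
by rewrite -pmulrn natrB ?(ltnW n_gt1) // pchar_Zp // sub0r.
Qed.

End Residues.

Section ResidueTheta.
Variables (R : realType) (eta : R[i]) (n : nat).
Hypothesis eta_upper : 0 < complex.Im eta.
Hypothesis n_gt1 : (1 < n)%N.
Local Notation C := R[i].
Implicit Types (z tau : C) (a b i j m : 'Z_n).

Let n_gt0 : (0 < n)%N := ltnW n_gt1.

Definition Th (a : 'Z_n) (z : C) : C := theta_ n eta a%:Z z.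

(** Subscripts computed on representatives may be replaced by residues. *)
Lemma theta_Th (alpha : int) z : theta_ n eta alpha z = Th alpha%:~R z.
Proof.
have [c {1}->] := @Zp_intr_eq n n_gt1 alpha (alpha%:~R : 'Z_n)%:Z (esym (Zp_intrK _)).
exact: theta_level_modn.
Qed.

Lemma Th0_eq0 a : (Th a 0 == 0) = (a == 0).
Proof.
apply/eqP/eqP; rewrite /Th theta_level0_eq0 // -Zp_intr_eq0 // Zp_intrK.
  by move/eqP.
by move=> ->.
Qed.

Lemma Th_neq0 a z : ~ torsion_lattice n eta z -> Th a z != 0.
Proof. exact: theta_level_neq0. Qed.

Lemma Th_torsion z : torsion_lattice n eta z ->
  exists a0, forall a, (Th a z == 0) = (a == a0).
Proof.
move=> [p [l h]]; exists (- l%:~R) => a.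
have e1 := theta_level_torsion eta_upper n_gt0 a%:Z h.
have e2 : (a == - l%:~R) = (n%:Z %| l + a%:Z)%Z.
  by rewrite -Zp_intr_eq0 // rmorphD /= Zp_intrK addrC addr_eq0.
by rewrite e2; apply/eqP/idP => /e1.
Qed.

Lemma Th_shift z l : lattice eta l ->
  exists2 u : C, u != 0 & forall a, Th a (z + l) = u * Th a z.
Proof.
by move=> /(theta_level_shift eta_upper n_gt0 z)[u u0 hu]; exists u => // a; exact: hu.
Qed.

Lemma Th_derivable a z : derivable (Th a) z 1.
Proof. exact: theta_level_derivable. Qed.

(** The additive character [k |-> e (k / n)] of the residues. *)
Definition chi (a : 'Z_n) : C := expi (a%:R / n%:R).

Lemma chi_neq0 a : chi a != 0. Proof. exact: expi_neq0. Qed.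

Lemma chi_int (alpha : int) : expi (alpha%:~R / n%:R) = chi alpha%:~R.
Proof.
have n0 : n%:R != 0 :> C := nC_neq0 R n_gt0.
have [c {1}->] := @Zp_intr_eq n n_gt1 alpha (alpha%:~R : 'Z_n)%:Z (esym (Zp_intrK _)).
rewrite /chi rmorphD rmorphM /= -!pmulrn mulrDl mulfK // expiD expi_int.
by rewrite mulr1.
Qed.

Lemma chiD a b : chi (a + b) = chi a * chi b.
Proof.
rewrite -[in LHS](Zp_intrK a) -[in LHS](Zp_intrK b) -rmorphD -chi_int.
by rewrite rmorphD mulrDl expiD.
Qed.

Lemma Th_opp a z : Th a (- z) = - expi (- (n%:R * z)) * chi a * Th (- a) z.
Proof.
rewrite /Th theta_level_opp // expiD -mulNr; congr (_ * _ * _).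
by rewrite theta_Th rmorphN /= Zp_intrK.
Qed.

(** What depends on [a] and [b] in the numerator of the coefficient of
    [x_a (x) x_b] in a relation. *)
Definition kappa (a b : 'Z_n) : C := chi b * Th (a - b) 0.

Lemma kappa_antisym a b : kappa b a = - kappa a b.
Proof.
rewrite /kappa -(opprB a b) -[X in Th _ X]oppr0 Th_opp.
rewrite mulr0 oppr0 -[0]/(0%:~R) expi_int mulN1r opprK !mulNr mulrN mulrA.
by rewrite -chiD opprB addrC subrK.
Qed.

Lemma kappa_eq0 a b : (kappa a b == 0) = (a == b).
Proof. by rewrite mulf_eq0 (negPf (chi_neq0 _)) /= Th0_eq0 subr_eq0. Qed.

End ResidueTheta.

(** * The relations and their extension to the torsion points *)

Lemma derivable_prod (R : realType) (I : Type) (s : seq I) (P : pred I)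
    (f : I -> R[i] -> R[i]) (z : R[i]) :
  (forall i, derivable (f i) z 1) ->
  derivable (fun w => \prod_(i <- s | P i) f i w) z 1.
Proof.
move=> df; elim: s => [|i s IH].
  by under eq_fun do rewrite big_nil; exact: derivable_cst.
under eq_fun do rewrite big_cons.
by case: (P i); [exact: (derivableM (df i) IH)|exact: IH].
Qed.

Lemma vline_scale (K : fieldType) (V : vectType K) (s : K) (v : V) : s != 0 ->
  (<[s *: v]> = <[v]>)%VS.
Proof.
move=> s0; apply/eqP; rewrite eqEsubv -!memvE memvZ ?memv_line //=.
apply/vlineP; exists s^-1; by rewrite scalerA mulVf ?scale1r.
Qed.

Section Relations.
Variables (R : realType) (eta : R[i]) (n : nat).
Hypothesis eta_upper : 0 < complex.Im eta.
Hypothesis n_gt1 : (1 < n)%N.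
Local Notation C := R[i].
Local Notation VV := (tensor2 R n).
Implicit Types (z tau : C) (a b c d i j m : 'Z_n).

Local Notation Th := (Th eta).
Local Notation kappa := (kappa eta).
Local Notation r := (@r_ R n (n - 1) eta).

Let n_gt0 : (0 < n)%N := ltnW n_gt1.

Definition rel_scale (j : 'Z_n) (tau : C) : C :=
  - expi (n%:R * tau) * chi R (- j).

Lemma rel_scale_neq0 j tau : rel_scale j tau != 0.
Proof. by rewrite mulf_neq0 ?chi_neq0 // oppr_eq0 expi_neq0. Qed.

(** A single term of the sum contributes, that of index [j - a]. The reflection
    formula [Th_opp] makes the two factors of the denominator alike. *)
Lemma r_entry i j tau a b : ~ torsion_lattice n eta tau -> r i j tau a b =
  if a + b == i + j then
    rel_scale j tau * kappa a b / (Th (a - j) tau * Th (b - j) tau)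
  else 0.
Proof.
move=> tauT; rewrite /r_ summxE.
under eq_bigr => s _ do rewrite mxE mxE.
have [ab|ab] := eqVneq (a + b) (i + j); last first.
  rewrite big1 // => s _; case: eqP => [aj|] /=; last by rewrite mulr0.
  case: eqP => [bi|]; last by rewrite mulr0.
  by case/eqP: ab; rewrite aj bi; ring.
rewrite (bigD1 (j - a)) // big1 ?addr0; last first.
  move=> s sj; case: eqP => [aj|]; last by rewrite mulr0.
  by case/eqP: sj; rewrite aj opprB addrC subrK.
have bE : b = i + j - a by rewrite -ab addrC addKr.
have -> : j - (j - a) = a by ring.
have -> : i + (j - a) = b by rewrite bE addrA.
rewrite !eqxx mulr1 ?addr0.
have [s sE] : exists s, s = j - a by exists (j - a).
rewrite -sE !(theta_Th eta_upper n_gt1).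
rewrite !(rmorphM, rmorphB, rmorphD) /= !Zp_intrK Zp_pred_natr // {s}sE.
have -> : j - i + (-1 - 1%:~R) * (j - a) = a - b by rewrite bE; ring.
have -> : j - i - (j - a) = j - b by rewrite bE; ring.
have -> : -1 * (j - a) = a - j by ring.
rewrite (Th_opp eta_upper n_gt1) opprB /rel_scale /kappa chiD //.
have -> : expi (- (n%:R * tau)) = (expi (n%:R * tau))^-1 :> C.
  by rewrite -!expiE eN.
have -> : chi R (- b) = (chi R b)^-1.
  apply: (mulfI (chi_neq0 R b)).
  by rewrite -chiD // subrr mulfV ?chi_neq0 // /chi mul0r -expiE e0.
have -> : chi R (- j) = (chi R j)^-1.
  apply: (mulfI (chi_neq0 R j)).
  by rewrite -chiD // subrr mulfV ?chi_neq0 // /chi mul0r -expiE e0.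
have := Th_neq0 eta_upper n_gt1 (a - j) tauT.
have := Th_neq0 eta_upper n_gt1 (b - j) tauT.
move: (chi_neq0 R b) (chi_neq0 R j) (expi_neq0 (n%:R * tau)).
move: (Th (a - b) 0) (Th (a - j) tau) (Th (b - j) tau) (chi R b) (chi R j).
move: (expi (n%:R * tau)) => E x y v cb cj cb0 cj0 E0 v0 y0.
by field; rewrite E0 cb0 cj0 v0 y0.
Qed.

Definition cleared_index (i j a b al : 'Z_n) : bool :=
  [&& al + al != i - j, al != a - j & al != b - j].

(** [r i j] with its poles cleared: multiplied by the theta functions whose
    index [al] does not satisfy [2 al = i - j]. The excluded indices are those
    for which no coefficient of [r i j] has a pole, as [kappa] vanishes there. *)
Definition cleared_r (i j : 'Z_n) (tau : C) : VV :=
  \matrix_(a, b) if a + b == i + j then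
    kappa a b * \prod_(al | cleared_index i j a b al) Th al tau else 0.

(** The two indices in the denominator of an off-diagonal coefficient are
    distinct, and both are among those by which [r i j] is multiplied in
    [cleared_r]. *)
Lemma index_offdiag i j a b : a + b = i + j -> a != b ->
  [/\ (a - j) + (a - j) != i - j, (b - j) + (b - j) != i - j & a - j != b - j].
Proof.
move=> ab anb.
have iE : i = a + b - j by rewrite ab addrK.
split; last by rewrite (inj_eq (addIr _)).
- have -> : (a - j) + (a - j) = i - j + (a - b) by rewrite iE; ring.
  by rewrite -subr_eq0 addrC addKr subr_eq0.
- have -> : (b - j) + (b - j) = i - j - (a - b) by rewrite iE; ring.
  by rewrite -subr_eq0 addrC addKr oppr_eq0 subr_eq0.
Qed.

Lemma prod_cleared i j a b (F : 'Z_n -> C) : a + b = i + j -> a != b ->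
  \prod_(al | al + al != i - j) F al
    = F (a - j) * F (b - j) * \prod_(al | cleared_index i j a b al) F al.
Proof.
move=> ab anb; have [h1 h2 h3] := index_offdiag ab anb.
rewrite (bigD1 (a - j)) //= (bigD1 (b - j)) /=; last by rewrite h2 eq_sym h3.
by rewrite mulrA; congr (_ * _); apply: eq_bigl => al; rewrite -andbA.
Qed.

Lemma r_proportional i j tau : ~ torsion_lattice n eta tau ->
  exists2 s : C, s != 0 & r i j tau = s *: cleared_r i j tau.
Proof.
move=> tauT; have T0 a := @Th_neq0 R eta n eta_upper n_gt1 a tau tauT.
exists (rel_scale j tau / \prod_(al | al + al != i - j) Th al tau).
  rewrite mulf_neq0 ?rel_scale_neq0 // invr_eq0.
  by apply/prodf_neq0 => al _.
apply/matrixP => a b; rewrite r_entry // mxE [RHS]mulrC mxE.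
case: eqP => [ab|_]; last by rewrite mul0r.
have [<-|anb] := eqVneq a b.
  have /eqP -> : kappa a a == 0 by rewrite kappa_eq0.
  by rewrite !(mulr0, mul0r).
rewrite (prod_cleared (fun al => Th al tau) ab anb).
set P := \prod_(al | _) _; have P0 : P != 0 by apply/prodf_neq0 => al _.
move: (T0 (a - j)) (T0 (b - j)) P0.
move: (Th (a - j) tau) (Th (b - j) tau) (kappa a b) (rel_scale j tau).
by move=> x y k s x0 y0 P0; field; rewrite x0 y0 P0.
Qed.

Definition offdiag_pair (i j : 'Z_n) :=
  [exists ab : 'Z_n * 'Z_n, (ab.1 + ab.2 == i + j) && (ab.1 != ab.2)].

(** At a torsion point only one index [a0] is dangerous. Either [2 a0 = i - j] and
    it never occurs in the products, or the coefficient of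
    [x_(j + a0) (x) x_(i - a0)] avoids it. *)
Lemma cleared_r_neq0 i j tau : offdiag_pair i j -> cleared_r i j tau != 0.
Proof.
case/existsP=> -[a b] /= /andP[/eqP ab anb].
have entry c d : c + d = i + j -> c != d ->
    (forall al, cleared_index i j c d al -> Th al tau != 0) ->
    cleared_r i j tau != 0.
  move=> cd cnd h; apply/eqP => /matrixP/(_ c d)/eqP; rewrite !mxE cd eqxx.
  rewrite mulf_eq0 kappa_eq0 // (negPf cnd) /= => /eqP.
  by apply/eqP/prodf_neq0 => al; exact: h.
have [T|T] := pselect (torsion_lattice n eta tau); last first.
  by apply: entry ab anb _ => al _; exact: Th_neq0.
have [a0 ha0] := Th_torsion eta_upper n_gt1 T.
have [a0ij|a0ij] := eqVneq (a0 + a0) (i - j).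
  apply: entry ab anb _ => al; rewrite ha0 => /and3P[+ _ _].
  by apply: contraNneq => ->; rewrite a0ij.
apply: (entry (j + a0) (i - a0)); first by ring.
  apply: contraNneq a0ij => h; have -> : a0 + a0 = (j + a0) + a0 - j by ring.
  by rewrite h; apply/eqP; ring.
move=> al; rewrite ha0 => /and3P[_ + _].
by rewrite addrC addKr.
Qed.

Lemma cleared_r_antisym i j tau a b : cleared_r i j tau b a = - cleared_r i j tau a b.
Proof.
rewrite !mxE addrC; case: ifP => _; last by rewrite oppr0.
rewrite kappa_antisym // mulNr; congr (- (_ * _)).
by apply: eq_bigl => al; rewrite /cleared_index; case: (_ != _) => //=;
  rewrite andbC.
Qed.

Lemma cleared_r_diag0 i j tau : ~~ offdiag_pair i j -> cleared_r i j tau = 0.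
Proof.
move=> /existsPn h; apply/matrixP => a b; rewrite !mxE.
case: eqP => // ab; have := h (a, b); rewrite /= ab eqxx /= negbK => /eqP ->.
by have /eqP -> : kappa b b == 0; [rewrite kappa_eq0|rewrite mul0r].
Qed.

Lemma lattice_half (x : R) (p l : int) : 0 < x < 1 ->
  ~ lattice eta (p%:~R + l%:~R * eta + x%:C).
Proof.
move=> /andP[x0 x1] [p' [l' h]].
have Imint (k : int) : complex.Im (k%:~R : C) = 0.
  by rewrite -(rmorph_int (real_complex R)).
have := congr1 (@complex.Im R) h; rewrite !ImD !Im_intM !Imint /= addr0 !add0r.
move=> /(mulIf (lt0r_neq0 eta_upper))/eqP; rewrite eqr_int => /eqP ll.
move: h; rewrite ll addrAC => /addIr/(congr1 (@complex.Re R)).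
rewrite -!(rmorph_int (real_complex R)) /= => h.
have [|] := leP (p' - p) 0.
  by rewrite -(ler_int R) rmorphB /= -h addrAC subrr add0r leNgt x0.
rewrite gtz0_ge1 -(ler_int R) rmorphB /= -h addrAC subrr add0r.
by rewrite leNgt x1.
Qed.

(** Real shifts by less than [1 / n] leave the torsion points. *)
Lemma torsion_approx tau : torsion_lattice n eta tau ->
  exists2 u : nat -> C, u @ \oo --> tau &
    forall N, ~ torsion_lattice n eta (u N).
Proof.
move=> [p [l h]].
have nR : 0 < n%:R :> R by rewrite ltr0n.
exists (fun N => tau + (n%:R * (N.+2)%:R)^-1%:C); last first.
  move=> N; rewrite /torsion_lattice /= mulrDr h.
  have -> : n%:R * (n%:R * N.+2%:R)^-1%:C = (N.+2%:R^-1 : R)%:C.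
    rewrite -(rmorph_nat (real_complex R)) -rmorphM; congr (_%:C).
    by rewrite invfM mulrA mulfV ?mul1r // gt_eqF.
  by apply: lattice_half; rewrite invr_gt0 ltr0n /= invf_lt1 ?ltr0n ?ltr1n.
apply/cvg_normcP => eps e0.
have : \forall N \near \oo, N.+1%:R^-1 < eps.
  have /cvgrPdist_lt/(_ _ e0) := @cvg_harmonic R; apply: filterS => N.
  by rewrite /harmonic sub0r normrN ger0_norm // invr_ge0.
apply: filterS => N; apply: le_lt_trans.
rewrite addrAC subrr add0r normc_real ger0_norm ?invr_ge0 ?mulr_ge0 //.
rewrite lef_pV2 ?posrE ?mulr_gt0 ?ltr0n //.
by rewrite -natrM ler_nat -[leqLHS]mul1n leq_mul.
Qed.

Lemma nontorsion_exists : exists tau, ~ torsion_lattice n eta tau.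
Proof.
have [|u _ hu] := @torsion_approx 0; last by exists (u 0%N).
by exists 0, 0; rewrite mulr0 mul0r addr0.
Qed.

Lemma r_nonzeroP i j : r_nonzero (n - 1) eta i j <-> offdiag_pair i j.
Proof.
split=> [[tau tauT]|].
  apply: contraNT => /(cleared_r_diag0 tau) g0.
  by have [s _ ->] := r_proportional i j tauT; rewrite g0 scaler0.
have [tau tauT] := nontorsion_exists.
move=> /(cleared_r_neq0 tau) g0; exists tau => //.
by have [s s0 ->] := r_proportional i j tauT; rewrite scaler_eq0 (negPf s0).
Qed.

Lemma cleared_r_derivable i j a b z : derivable (fun w => cleared_r i j w a b) z 1.
Proof.
under eq_fun do rewrite mxE.
case: ifP => _; last exact: derivable_cst.
apply: derivableM; first exact: derivable_cst.
by apply: derivable_prod => al; exact: Th_derivable.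
Qed.

Definition free_index (i j : 'Z_n) : pred 'Z_n := fun al => al + al != i - j.

(** All nonzero coefficients are products of equally many factors, so that a
    shift by a period multiplies them all by the same constant. *)
Lemma card_cleared i j a b : a + b = i + j -> a != b ->
  #|cleared_index i j a b| = (#|free_index i j| - 2)%N.
Proof.
move=> ab anb; have [h1 h2 h3] := index_offdiag ab anb.
rewrite (cardD1 (a - j) (free_index i j)).
rewrite (cardD1 (b - j) [predD1 free_index i j & a - j]).
rewrite !inE /in_mem /= /free_index h1 h2 eq_sym h3 /= !add1n subSS subSS subn0.
apply: eq_card => al; rewrite !inE /in_mem /= /cleared_index.
by case: (al == a - j); case: (al == b - j); rewrite ?andbF ?andbT.
Qed.

Lemma cleared_r_shift i j z l : lattice eta l ->
  exists2 u : C, u != 0 & cleared_r i j (z + l) = u *: cleared_r i j z.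
Proof.
move=> /(Th_shift eta_upper n_gt1 z)[u u0 hu].
exists (u ^+ (#|free_index i j| - 2)).
  by rewrite expf_neq0.
apply/matrixP => a b; rewrite !mxE; case: eqP => [ab|_]; last by rewrite mulr0.
have [<-|anb] := eqVneq a b.
  have /eqP -> : kappa a a == 0 by rewrite kappa_eq0.
  by rewrite !(mulr0, mul0r).
rewrite -(card_cleared ab anb) mulrCA; congr (_ * _).
under eq_bigr do rewrite hu.
by rewrite big_split /= prodr_const.
Qed.

Lemma cleared_r_morphism i j : offdiag_pair i j ->
  morphism_to_lines eta (fun tau => <[cleared_r i j tau]>%VS).
Proof.
move=> ij; split=> [z l /(cleared_r_shift i j z)[u u0 ->]|z0].
  by rewrite vline_scale.
exists (cleared_r i j); apply: filterE => z; split=> //; first exact: cleared_r_neq0.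
by move=> a b; exact: cleared_r_derivable.
Qed.

Lemma cleared_r_extends i j :
  extends_r (n - 1) eta i j (fun tau => <[cleared_r i j tau]>%VS).
Proof. by move=> tau /(r_proportional i j)[s s0 ->]; rewrite vline_scale. Qed.

Lemma line_eq_minors (u v : VV) : u != 0 -> v != 0 ->
  (forall a b c d, u a b * v c d = u c d * v a b) -> (<[u]> = <[v]>)%VS.
Proof.
move=> u0 v0 h.
have [a [b uab]] : exists a b, u a b != 0.
  apply: contrapT => hn; case/eqP: u0; apply/matrixP => a b; rewrite mxE.
  by apply/eqP; apply: contrapT => uab; apply: hn; exists a, b; apply/negP.
have vE : v = (v a b / u a b) *: u.
  by apply/matrixP => c d; rewrite mxE mulrAC mulrC -[v a b * _]mulrC -h mulKf.
rewrite [in RHS]vE vline_scale //; apply: contraNneq v0 => s0.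
by rewrite vE s0 scale0r.
Qed.

(** Torsion points are limits of other points, and the two-by-two minors of two
    holomorphic generators are continuous. *)
Lemma extension_unique i j L : offdiag_pair i j -> morphism_to_lines eta L ->
  extends_r (n - 1) eta i j L -> L = fun tau => <[cleared_r i j tau]>%VS.
Proof.
move=> ij [_ Lloc] Lext; apply/funext => tau.
have off z : ~ torsion_lattice n eta z -> L z = <[cleared_r i j z]>%VS.
  by move=> zT; rewrite Lext // (cleared_r_extends i j zT).
have [T|/off //] := pselect (torsion_lattice n eta tau).
have [u utau uT] := torsion_approx T.
have [f nearf] := Lloc tau.
have [f0 -> fd] := nbhs_singleton nearf.
apply: line_eq_minors => // [|a b c d]; first exact: cleared_r_neq0.
have cont (h : C -> C) : derivable h tau 1 -> h (u N) @[N --> \oo] --> h tau.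
  by move=> /derivable1_diffP/differentiable_continuous hc; exact: cvg_comp utau hc.
have lim1 : f (u N) a b * cleared_r i j (u N) c d @[N --> \oo]
    --> f tau a b * cleared_r i j tau c d.
  exact: cvgM (cont _ (fd a b)) (cont _ (@cleared_r_derivable i j c d tau)).
have lim2 : f (u N) c d * cleared_r i j (u N) a b @[N --> \oo]
    --> f tau c d * cleared_r i j tau a b.
  exact: cvgM (cont _ (fd c d)) (cont _ (@cleared_r_derivable i j a b tau)).
apply: (cvg_unique (@norm_hausdorff _ _) lim1).
apply: cvg_trans lim2; apply: near_eq_cvg.
have nearu : \forall N \near \oo, L (u N) = <[f (u N)]>%VS.
  have [M _ hM] := utau _ nearf.
  by exists M => // N /hM[].
apply: filterS nearu => N; rewrite off // => hN.
have /vlineP[k gk] : cleared_r i j (u N) \in <[f (u N)]>%VS by rewrite -hN memv_line.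
by rewrite /= gk !mxE; ring.
Qed.

Lemma L_E i j : offdiag_pair i j ->
  L_ (n - 1) eta i j = fun tau => <[cleared_r i j tau]>%VS.
Proof.
move=> ij; apply: xget_unique;
  first by split; [exact: cleared_r_morphism|exact: cleared_r_extends].
by move=> L [? ?]; exact: extension_unique.
Qed.

End Relations.

(** * The relations span the antisymmetric tensors *)

Section Span.
Variables (R : realType) (eta : R[i]) (n : nat) (tau : R[i]).
Hypothesis eta_upper : 0 < complex.Im eta.
Hypothesis n_gt1 : (1 < n)%N.
Local Notation C := R[i].
Local Notation VV := (tensor2 R n).
Implicit Types (a b c d i j m : 'Z_n).

Local Notation Th := (Th eta).
Local Notation kappa := (kappa eta).
Local Notation g := (@cleared_r R eta n).
Local Notation relations := (rel_nk n (n - 1) eta tau).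

Let n_gt0 : (0 < n)%N := ltnW n_gt1.

Lemma cleared_r_in_rel i j : g i j tau \in relations.
Proof.
have [ij|ij] := boolP (offdiag_pair i j); last first.
  by rewrite cleared_r_diag0 // mem0v.
rewrite memvE; apply: (sumv_sup (i, j)); rewrite /= ?L_E //.
by apply/asboolP/r_nonzeroP.
Qed.

Lemma rel_antisym (t : VV) a b : t \in relations -> t b a = - t a b.
Proof.
move=> /memv_sumP[v hv ->]; rewrite !summxE -sumrN; apply: eq_bigr => -[i j].
move=> ij; have := hv _ ij; move: ij => /= /asboolP/(r_nonzeroP eta_upper n_gt1) ij.
rewrite L_E // => /vlineP[k ->]; rewrite mxE [X in - X]mxE.
by rewrite cleared_r_antisym // mulrN.
Qed.

Definition wedge (a b : 'Z_n) : VV := delta_mx a b - delta_mx b a.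

(** Let [a0] be the only index with [Th a0 tau = 0]. For [j = a - a0] and the
    weight [a + b], the factor [Th a0 tau] occurs in all coefficients of
    [cleared_r] but those of [x_a (x) x_b] and [x_b (x) x_a], whose excluded
    indices include [a - j]. *)
Lemma wedge_torsion a b : torsion_lattice n eta tau -> a != b ->
  wedge a b \in relations.
Proof.
move=> /(Th_torsion eta_upper n_gt1)[a0 ha0] anb.
pose j := a - a0; pose i := b + a0.
have ab : a + b = i + j by rewrite /i /j; ring.
have aj : a - j = a0 by rewrite /j; ring.
pose k := kappa a b * \prod_(al | cleared_index i j a b al) Th al tau.
have k0 : k != 0.
  rewrite mulf_neq0 ?kappa_eq0 //; apply/prodf_neq0 => al /and3P[_ al_a _].
  by rewrite ha0 -aj.
have gE : g i j tau = k *: wedge a b.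
  apply/matrixP => c d; rewrite !mxE.
  have [cd|cd] := eqVneq (c + d) (i + j); last first.
    have -> : (c == a) && (d == b) = false.
      by apply: contraNF cd => /andP[/eqP -> /eqP ->]; rewrite ab.
    have -> : (c == b) && (d == a) = false.
      by apply: contraNF cd => /andP[/eqP -> /eqP ->]; rewrite addrC ab.
    by rewrite subrr mulr0.
  have dE : d = a + b - c by rewrite ab -cd addrC addKr.
  have [ca|ca] := eqVneq c a.
    have db : d = b by rewrite dE ca addrC addKr.
    by rewrite ca db eqxx /= (negPf anb) /= subr0 mulr1.
  have [cb|cb] := eqVneq c b.
    have da : d = a by rewrite dE cb addrK.
    rewrite cb da eqxx /= sub0r mulrN1 /k kappa_antisym // mulNr.
    congr (- (_ * _)); apply: eq_bigl => al; rewrite /cleared_index.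
    by case: (_ != _) => //=; rewrite andbC.
  rewrite /= subrr mulr0 (bigD1 a0) /=.
    have /eqP -> : Th a0 tau == 0 by rewrite ha0.
    by rewrite mul0r mulr0.
  apply/and3P; split.
  - rewrite /i /j; apply: contraNneq anb => h; rewrite -subr_eq0.
    rewrite (_ : a - b = (a0 + a0) - (b + a0 - (a - a0))); last by ring.
    by rewrite -h subrr.
  - by rewrite -aj eq_sym (inj_eq (addIr _)).
  - rewrite -aj eq_sym (inj_eq (addIr _)) dE; apply: contraNneq cb => h.
    by apply/eqP/(addrI a); rewrite -{1}h subrK.
have := cleared_r_in_rel i j; rewrite gE rpredZeq (negPf k0) //.
Qed.

(** A family [h] that changes sign under [c -> m - c] is carried by the
    residues [a] that precede [m - a]. *)
Lemma antisym_decomp m (h : 'Z_n -> C) : (forall c, h (m - c) = - h c) ->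
  (\matrix_(c, d) if c + d == m then h c else 0) =
  \sum_(a : 'Z_n | (a < (m - a)%R)%N) h a *: wedge a (m - a) :> VV.
Proof.
move=> hm; apply/matrixP => c d; rewrite mxE summxE.
have hmE a : (h a *: wedge a (m - a)) c d
    = h a * ((a == c) && (d == m - c))%:R - h a * ((a == d) && (c == m - d))%:R.
  rewrite !mxE mulrBr; congr (_ * _%:R - _ * _%:R).
    by rewrite eq_sym; case: eqP => // ->.
  by rewrite andbC eq_sym; case: eqP => // ->.
under eq_bigr => a _ do rewrite hmE.
rewrite sumrB.
have pick (x y : 'Z_n) :
    \sum_(a : 'Z_n | (a < (m - a)%R)%N) h a * ((a == x) && (y == m - x))%:R
    = if (x < (m - x)%R)%N && (y == m - x) then h x else 0.
  rewrite big_mkcond (bigD1 x) //= big1 ?addr0 => [|a ax].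
    by rewrite eqxx /=; case: ifP => //=; case: (y == _); rewrite ?mulr1 ?mulr0.
  by rewrite (negPf ax) mulr0; case: ifP.
rewrite !pick; have [cd|cd] := eqVneq (c + d) m; last first.
  have -> : (d == m - c) = false.
    by apply: contraNF cd => /eqP ->; rewrite addrC subrK.
  have -> : (c == m - d) = false.
    by apply: contraNF cd => /eqP ->; rewrite subrK.
  by rewrite !andbF subrr.
have dE : d = m - c by rewrite -cd addrC addKr.
have cE : c = m - d by rewrite -cd addrK.
rewrite -dE -cE !eqxx !andbT.
have hd : h d = - h c by rewrite dE.
case: (ltngtP c d) => [_|_|/val_inj cd']; rewrite ?subr0 ?sub0r //.
  by rewrite hd opprK.
move: hd; rewrite -cd' => /eqP; rewrite -subr_eq0 opprK -mulr2n mulrn_eq0 /=.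
by move=> /eqP.
Qed.

Lemma lattice_sub (u v : C) (l : C) : lattice l u -> lattice l v ->
  lattice l (u - v).
Proof.
move=> [a [b ->]] [a' [b' ->]]; exists (a - a'), (b - b').
by rewrite !rmorphB /=; ring.
Qed.

Lemma Zp_lattice (x y : int) : lattice (n%:R * eta) ((x - y)%:~R * eta) ->
  x%:~R = y%:~R :> 'Z_n.
Proof.
move=> h; apply/eqP; rewrite -subr_eq0 -rmorphB Zp_intr_eq0 //.
by rewrite -(lattice_coords n eta_upper 0) add0r.
Qed.

(** The reflection [a -> t - a] shows that the left side is at most half of the
    number of residues, and likewise that the right side is at least half. *)
Lemma half_card (s t : 'Z_n) :
  (size [seq a : 'Z_n <- enum 'Z_n | (a < (t - a)%R)%N]
     <= size [seq j : 'Z_n <- enum 'Z_n | (j <= (s - j)%R)%N])%N.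
Proof.
have cnt (P : pred 'Z_n) : size [seq a : 'Z_n <- enum 'Z_n | P a]
    = (\sum_(a : 'Z_n) P a)%N.
  rewrite size_filter -sum1_count big_enum_cond big_mkcond /=.
  by apply: eq_bigr => a _; case: (P a).
have refl (u : 'Z_n) (P : rel nat) : (\sum_(a : 'Z_n) P a (u - a)%R
    = \sum_(a : 'Z_n) P (u - a)%R a)%N.
  rewrite (reindex_inj (h := fun a : 'Z_n => u - a)) => [|a b /addrI/oppr_inj//].
  by apply: eq_bigr => a _; rewrite subKr.
rewrite !cnt -(leq_pmul2l (isT : 0 < 2)%N).
apply: (@leq_trans (\sum_(a : 'Z_n) 1)%N).
  rewrite mul2n -addnn {2}(refl t (fun x y => x < y)%N) -big_split leq_sum // => a _.
  by case: ltngtP.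
rewrite mul2n -addnn {2}(refl s (fun x y => x <= y)%N) -big_split leq_sum // => a _.
by have := leq_total a (s - a)%R; case: (_ <= _)%N => //= ->.
Qed.

(** Off the torsion points, the coefficients of the relations of a given weight
    [m] form a Cauchy matrix. Two rows agree only when [j + k] is one
    distinguished residue [s], so that half of them are pairwise distinct, and
    half of the residues suffice as there are as many unordered pairs. *)
Lemma wedge_nontorsion a0 b0 : ~ torsion_lattice n eta tau -> a0 != b0 ->
  wedge a0 b0 \in relations.
Proof.
move=> tauT; wlog ab0 : a0 b0 / (a0 < b0)%N => [hw a0b0|_].
  have := a0b0; rewrite -val_eqE neq_ltn => /orP[/hw|/hw h]; first exact.
  by rewrite -rpredN opprB h // eq_sym.
have [m mE] : exists m, m = a0 + b0 by exists (a0 + b0).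
have [A [B [hAB [u [v [u0 [v0 huv]]]]]]] :=
  theta_level_pair eta_upper n_gt0 tau m%:Z.
pose x (j : int) := n%:R * tau + (m%:Z%:~R / 2 - j%:~R) * eta.
pose y (a : int) := (a%:~R - m%:Z%:~R / 2) * eta.
pose p (j : 'Z_n) := (A (x j%:Z), B (x j%:Z)).
pose q (a : 'Z_n) := (A (y a%:Z), B (y a%:Z)).
have hD z w : theta (n%:R * eta) (z + w) * theta (n%:R * eta) (z - w)
    = expi z * det2 (A z, B z) (A w, B w) by exact: hAB.
have neta_up := neta_upper eta_upper n_gt0.
have det_neq0 z w : ~ lattice (n%:R * eta) (z + w) ->
    ~ lattice (n%:R * eta) (z - w) -> det2 (A z, B z) (A w, B w) != 0.
  move=> h1 h2; apply/eqP => d0; have := hD z w; rewrite d0 mulr0.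
  move/eqP; rewrite mulf_eq0 => /orP[] /eqP /(theta_eq0 _ neta_up).
    exact: h1.
  exact: h2.
have hpair a j : Th (a - j) tau * Th (m - a - j) tau
    = u j%:Z * v a%:Z * det2 (p j) (q a).
  rewrite /p /q /x /y /det2 /= -huv !(theta_Th eta_upper n_gt1).
  rewrite !rmorphB /=.
  by rewrite !Zp_intrK.
have T0 a : Th a tau != 0 by exact: Th_neq0.
have pq0 j a : det2 (p j) (q a) != 0.
  have : Th (a - j) tau * Th (m - a - j) tau != 0 by rewrite mulf_neq0.
  by rewrite hpair mulf_eq0 negb_or => /andP[].
(* The determinant of the rows [j] and [k] can only vanish if [x j + x k] is in
   the lattice, which fixes [j + k]. *)
have [s hs] : exists s : 'Z_n, forall j k : 'Z_n,
    lattice (n%:R * eta) (x j%:Z + x k%:Z) -> j + k = s.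
  have [[j0 [k0 jk0]]|no] := pselect (exists j k : 'Z_n,
      lattice (n%:R * eta) (x j%:Z + x k%:Z)); last first.
    by exists 0 => j k jk; case: no; exists j, k.
  exists (j0 + k0) => j k jk; have := lattice_sub jk0 jk.
  have -> : x j0%:Z + x k0%:Z - (x j%:Z + x k%:Z)
      = ((j%:Z + k%:Z) - (j0%:Z + k0%:Z))%:~R * eta.
    by rewrite /x !(rmorphB, rmorphD) /=; ring.
  by move=> /Zp_lattice; rewrite !rmorphD /= !Zp_intrK.
(* One index in each pair [{j, s - j}], and one in each [{a, m - a}]. *)
pose ps := [seq p j | j <- [seq j : 'Z_n <- enum 'Z_n | (j <= (s - j)%R)%N]].
pose qs := [seq a : 'Z_n <- enum 'Z_n | (a < (m - a)%R)%N].
pose w a := (kappa a (m - a) / v a%:Z) *: wedge a (m - a).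
suff : w a0 \in relations.
  have -> : w a0 = (kappa a0 b0 / v a0%:Z) *: wedge a0 b0.
    by rewrite /w mE addrC addKr.
  rewrite rpredZeq mulf_eq0 invr_eq0 kappa_eq0 // (negPf (v0 _)).
  by rewrite -val_eqE ltn_eqF.
apply: (@cauchy_span _ _ _ q _ ps qs).
- by rewrite size_map half_card.
- rewrite pairwise_map.
  have : pairwise (fun j k : 'Z_n => j != k)
      [seq j : 'Z_n <- enum 'Z_n | (j <= (s - j)%R)%N].
    by rewrite -uniq_pairwise filter_uniq ?enum_uniq.
  apply: sub_in_pairwise (filter_all _ _) => j k.
  move=> js ks jk.
  have {}js : (j <= (s - j)%R)%N := js.
  have {}ks : (k <= (s - k)%R)%N := ks.
  apply: det_neq0; last first.
    have -> : x j%:Z - x k%:Z = (k%:Z - j%:Z)%:~R * eta.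
      by rewrite /x !rmorphB /=; ring.
    by move=> /Zp_lattice; rewrite !Zp_intrK => /esym/eqP; rewrite (negPf jk).
  move=> /hs jks; case/eqP: jk; apply: val_inj; apply/eqP; rewrite eqn_leq.
  have sj : s - j = k by rewrite -jks addrC addKr.
  have sk : s - k = j by rewrite -jks addrK.
  by rewrite sj in js; rewrite sk in ks; apply/andP; split.
- have : pairwise (fun j k : 'Z_n => j != k) qs.
    by rewrite -uniq_pairwise filter_uniq ?enum_uniq.
  apply: sub_in_pairwise (filter_all _ _) => a b.
  move=> am bm ab.
  have {}am : (a < (m - a)%R)%N := am.
  have {}bm : (b < (m - b)%R)%N := bm.
  apply: det_neq0; last first.
    have -> : y a%:Z - y b%:Z = (a%:Z - b%:Z)%:~R * eta.
      by rewrite /y !rmorphB /=; ring.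
    by move=> /Zp_lattice; rewrite !Zp_intrK => /eqP; rewrite (negPf ab).
  have -> : y a%:Z + y b%:Z = ((a%:Z + b%:Z) - m%:Z)%:~R * eta.
    by rewrite /y !(rmorphB, rmorphD) /=; field.
  move=> /Zp_lattice; rewrite rmorphD /= !Zp_intrK => abm.
  have ma : m - a = b by rewrite -abm addrC addKr.
  have mb : m - b = a by rewrite -abm addrK.
  rewrite ma in am; rewrite mb in bm.
  by have := ltn_trans am bm; rewrite ltnn.
- by move=> _ a /mapP[j _ ->] _; exact: pq0.
- move=> _ /mapP[j _ ->].
  have rS : r_ (n - 1) eta (m - j) j tau \in relations.
    have [k _ ->] := r_proportional eta_upper n_gt1 (m - j) j tauT.
    by rewrite rpredZ // cleared_r_in_rel.
  pose h c := kappa c (m - c) / (Th (c - j) tau * Th (m - c - j) tau).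
  have hm c : h (m - c) = - h c.
    by rewrite /h subKr kappa_antisym // mulNr (mulrC (Th _ _)).
  have rE : r_ (n - 1) eta (m - j) j tau
      = rel_scale j tau *: \matrix_(c, d) if c + d == m then h c else 0.
    apply/matrixP => c d; rewrite r_entry // subrK !mxE.
    case: eqP => [cd|_]; last by rewrite mulr0.
    by rewrite /h -cd addrAC subrr add0r mulrA.
  move: rS; rewrite rE rpredZeq (negPf (rel_scale_neq0 _ _)) orFb.
  rewrite antisym_decomp // => S.
  have -> : \sum_(a <- qs) (det2 (p j) (q a))^-1 *: w a
      = u j%:Z *: \sum_(a : 'Z_n | (a < (m - a)%R)%N) h a *: wedge a (m - a).
    rewrite big_filter big_enum_cond /= scaler_sumr; apply: eq_bigr => a _.
    rewrite /w !scalerA; congr (_ *: _); rewrite /h hpair.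
    move: (u0 j%:Z) (v0 a%:Z) (pq0 j a).
    move: (u j%:Z) (v a%:Z) (det2 _ _) (kappa _ _) => U V D K U0 V0 D0.
    by field; rewrite U0 V0 D0.
  by rewrite rpredZ.
- rewrite mem_filter mem_enum andbT mE addrC addKr. exact: ab0.
Qed.

Lemma rel_nkE (t : VV) :
  (t \in relations) <-> (forall a b, t b a = - t a b).
Proof.
split=> [tS a b|tN]; first exact: rel_antisym.
have wS a b : wedge a b \in relations.
  have [->|ab] := eqVneq a b; first by rewrite /wedge subrr mem0v.
  have [T|T] := pselect (torsion_lattice n eta tau).
    exact: wedge_torsion.
  exact: wedge_nontorsion.
have -> : t = 2^-1 *: \sum_a \sum_b t a b *: wedge a b.
  have -> : \sum_a \sum_b t a b *: wedge a b = t + t.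
    rewrite /wedge; under eq_bigr do under eq_bigr do rewrite scalerBr.
    under eq_bigr do rewrite sumrB.
    rewrite sumrB -matrix_sum_delta; congr (_ + _).
    rewrite exchange_big /= -sumrN [RHS]matrix_sum_delta.
    apply: eq_bigr => a _; rewrite -sumrN; apply: eq_bigr => b _.
    by rewrite tN scaleNr opprK.
  have -> : t + t = (2 : C) *: t by rewrite scaler_nat mulr2n.
  by rewrite scalerA mulVf ?scale1r // pnatr_eq0.
rewrite rpredZ //; apply: rpred_sum => a _; apply: rpred_sum => b _.
by rewrite rpredZ.
Qed.

End Span.

(** * The polynomial ring as the quotient by the commutators *)

Lemma commute_past (A : nzRingType) (x y u v : A) :
  (x * y - y * x) * u + y * (x * u - v) = x * (y * u) - y * v.
Proof. by rewrite mulrBl mulrBr !mulrA addrA subrK. Qed.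

Lemma sum_delta (K : nzRingType) (W : lmodType K) m (F : 'I_m -> 'I_m -> W) i j :
  \sum_a \sum_b delta_mx i j a b *: F a b = F i j.
Proof.
rewrite (bigD1 i) //= (bigD1 j) //= mxE !eqxx scale1r.
rewrite [X in _ + X + _]big1 => [|b bj]; last first.
  by rewrite mxE (negPf bj) andbF scale0r.
rewrite addr0 [X in _ + X]big1 ?addr0 // => a ai; apply: big1 => b _.
by rewrite mxE (negPf ai) scale0r.
Qed.

Section PolynomialRing.
Variables (R : realType) (n : nat).
Hypothesis n_gt1 : (1 < n)%N.
Local Notation C := R[i].
Local Notation TV := (tensor_algebra R n).
Local Notation poly_n := (mpoly.mpoly n C).
Local Notation p := (TV_to_poly R n_gt1).
Local Notation gen := (@gen R n).
Local Notation mon := (@FMonom 'Z_n).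

Definition word (s : seq 'Z_n) : TV := mkmalgU (mon s) 1.

Definition word_monomial (w : fmonom 'Z_n) : poly_n :=
  \prod_(i <- fmonom_val w) mpolyX C (mnm1 (cast_ord (Zp_cast n_gt1) i)).

Lemma word_monomial_mmorphism : mmorphism word_monomial.
Proof.
split=> [x y|]; rewrite /word_monomial; first by rewrite fmM big_cat.
by rewrite fm1 big_nil.
Qed.

HB.instance Definition _ := monalg.isMultiplicative.Build
  (fmonom 'Z_n) poly_n word_monomial word_monomial_mmorphism.

Lemma TV_to_poly_linear : linear p.
Proof.
move=> k a b; rewrite [LHS](monalg.mmapD (k *: a) b); congr (_ + _).
by rewrite [LHS](@monalg.mmapZ _ _ _ _ word_monomial) mul_mpolyC.
Qed.

Lemma TV_to_polyD a b : p (a + b) = p a + p b.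
Proof. by have := TV_to_poly_linear 1 a b; rewrite !scale1r. Qed.

Lemma TV_to_poly0 : p 0 = 0.
Proof. exact: monalg.mmap0. Qed.

Lemma TV_to_polyZ k a : p (k *: a) = k *: p a.
Proof. by have := TV_to_poly_linear k a 0; rewrite TV_to_poly0 !addr0. Qed.

Lemma TV_to_poly_sum I (r : seq I) (F : I -> TV) :
  p (\sum_(i <- r) F i) = \sum_(i <- r) p (F i).
Proof. exact: (big_morph _ TV_to_polyD TV_to_poly0). Qed.

Lemma TV_to_poly_mul : monoid_morphism p.
Proof.
have [hM h1] := @monalg.mmap_is_multiplicative _ _ _ (@mpolyC n C) word_monomial.
by split; [exact: h1 | exact: hM].
Qed.

Local Notation letter i := (cast_ord (Zp_cast n_gt1) i).
Local Notation residue i := (cast_ord (esym (Zp_cast n_gt1)) i).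

Definition exponent (s : seq 'Z_n) : multinom n :=
  Multinom [tuple count_mem (residue i) s | i < n].

Lemma exponentE s i : exponent s i = count_mem (residue i) s.
Proof. exact: mnmE. Qed.

Lemma TV_to_poly_word s : p (word s) = mpolyX C (exponent s).
Proof.
rewrite /TV_to_poly monalg.mmapU /= mpolyC1 mul1r.
elim: s => [|i s IH]; rewrite ?big_nil ?big_cons.
  by rewrite -mpolyX0; congr mpolyX; apply/mnmP => j; rewrite exponentE mnm0E.
rewrite IH -mpolyXD; congr mpolyX; apply/mnmP => j.
by rewrite mnmDE !exponentE mnm1E /= -(inj_eq (@cast_ord_inj _ _ (Zp_cast n_gt1)))
  cast_ordKV.
Qed.

Lemma perm_eq_exponent s t : exponent s = exponent t -> perm_eq s t.
Proof.
move=> st; apply/allP => x _ /=; apply/eqP.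
by have := congr1 (fun m : multinom n => m (letter x)) st; rewrite !exponentE cast_ordK.
Qed.

Definition increasing_word (m : multinom n) : seq 'Z_n :=
  flatten [seq nseq (m (letter i)) i | i <- enum 'Z_n].

Lemma exponent_increasing_word m : exponent (increasing_word m) = m.
Proof.
apply/mnmP => j; rewrite exponentE count_flatten -map_comp sumnE big_map.
rewrite big_enum (bigD1 (residue j)) //= count_nseq /= eqxx mul1n cast_ordKV.
rewrite big1 ?addn0 // => i ij.
by rewrite count_nseq /= (negPf ij).
Qed.

(** The increasing words lift the monomials. *)
Lemma TV_to_poly_surj b : exists a, p a = b.
Proof.
exists (\sum_(m <- mpoly.msupp b) mpoly.mcoeff m b *: word (increasing_word m)).
rewrite TV_to_poly_sum [RHS]mpolyE; apply: eq_bigr => m _.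
by rewrite TV_to_polyZ TV_to_poly_word exponent_increasing_word.
Qed.

Lemma gen_word i : gen i = word [:: i].
Proof. by rewrite /Defs.gen fmuE. Qed.

Lemma word_cat s t : word (s ++ t) = word s * word t.
Proof.
by rewrite /word malgM_def fgmulUU mulr1; congr mkmalgU; apply: val_inj; rewrite /= fmM.
Qed.

Lemma word_cons i s : word (i :: s) = gen i * word s.
Proof. by rewrite gen_word -word_cat. Qed.

Lemma sum_words (a : TV) :
  a = \sum_(w <- finmap.enum_fset (monalg.msupp a))
    monalg.mcoeff w a *: word (fmonom_val w).
Proof.
rewrite {1}[a]monalgE; apply: eq_bigr => w _.
by rewrite -mul_malgC malgM_def fgmulUU mulr1 mul1m /word fmK.
Qed.

Section Ideal.
Variable J : set TV.
Hypothesis J_ideal : two_sided_ideal J.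

Lemma ideal0 : J 0. Proof. by case: J_ideal. Qed.

Lemma idealD a b : J a -> J b -> J (a + b).
Proof. by case: J_ideal => _ h _; exact: h. Qed.

Lemma idealMl a b : J b -> J (a * b).
Proof. by case: J_ideal => _ _ h /(h a b 1); rewrite mulr1. Qed.

Lemma idealMr a b : J b -> J (b * a).
Proof. by case: J_ideal => _ _ h /(h 1 b a); rewrite mul1r. Qed.

Lemma idealZ k b : J b -> J (k *: b).
Proof. by rewrite -mul_malgC; exact: idealMl. Qed.

Lemma ideal_sum I (r : seq I) (F : I -> TV) :
  (forall i, J (F i)) -> J (\sum_(i <- r) F i).
Proof.
move=> JF; elim: r => [|i r IH]; rewrite ?big_nil ?big_cons; first exact: ideal0.
exact: idealD.
Qed.

Hypothesis J_comm : forall i j, J (gen i * gen j - gen j * gen i).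

(** Each commutator moves [x] past one letter. *)
Lemma ideal_move_letter x s t : J (word (x :: s ++ t) - word (s ++ x :: t)).
Proof.
elim: s => [|y s IH]; first by rewrite subrr; exact: ideal0.
have := idealD (idealMr (word (s ++ t)) (J_comm x y)) (idealMl (gen y) IH).
by rewrite (word_cons x (s ++ t)) commute_past -!word_cons.
Qed.

Lemma ideal_perm_words s t : perm_eq s t -> J (word s - word t).
Proof.
elim: s t => [|x s IH] t st.
  by move: st; rewrite perm_sym => /perm_nilP ->; rewrite subrr; exact: ideal0.
have : x \in t by rewrite -(perm_mem st) mem_head.
move=> /splitPr tE; case: tE st => t1 t2.
rewrite -[x :: t2]cat1s perm_sym perm_catCA /= perm_cons perm_sym => /IH Jst.
have := idealD (idealMl (gen x) Jst) (ideal_move_letter x t1 t2).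
by rewrite mulrBr -!word_cons addrA subrK.
Qed.

(** Modulo the commutators, a word is determined by its exponent, and the images
    of the words are the monomials, which are linearly independent. *)
Lemma ideal_ker a : p a = 0 -> J a.
Proof.
move=> pa0; pose S := finmap.enum_fset (monalg.msupp a); pose c w := monalg.mcoeff w a.
pose ex (w : fmonom 'Z_n) := exponent (fmonom_val w).
have coeff0 m : \sum_(w <- S | ex w == m) c w = 0.
  have := congr1 (mpoly.mcoeff m) pa0; rewrite mcoeff0 [in X in X -> _](sum_words a).
  rewrite TV_to_poly_sum raddf_sum /= => h.
  rewrite big_mkcond -[RHS]h; apply: eq_bigr => w _.
  rewrite TV_to_polyZ TV_to_poly_word mcoeffZ mcoeffX /ex.
  by case: eqP => _; rewrite ?mulr1 ?mulr0.
(* Grouped by exponent, the sum of the normalized words has the coefficients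
   of [p a]. *)
have E : \sum_(w <- S) c w *: word (increasing_word (ex w)) = 0.
  transitivity (\sum_(m <- undup (map ex S)) \sum_(w <- S | ex w == m)
      c w *: word (increasing_word m)); last first.
    by apply: big1 => m _; rewrite -scaler_suml coeff0 scale0r.
  under [RHS]eq_bigr do rewrite big_mkcond.
  rewrite exchange_big /= [LHS]big_seq [RHS]big_seq; apply: eq_bigr => w wS.
  rewrite (bigD1_seq (ex w)) ?undup_uniq ?mem_undup ?map_f //= eqxx.
  by rewrite big1 ?addr0 // => m /negPf; rewrite eq_sym => ->.
rewrite [a]sum_words -[X in J X]subr0 -[X in J (_ - X)]E -sumrB.
apply: ideal_sum => w; rewrite -scalerBr; apply: idealZ.
by apply: ideal_perm_words; apply: perm_eq_exponent; rewrite exponent_increasing_word.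
Qed.

End Ideal.

Lemma tensor2_in_TV_delta i j : tensor2_in_TV (delta_mx i j) = gen i * gen j.
Proof.
exact: (sum_delta (fun a b => gen a * gen b)).
Qed.

Lemma tensor2_in_TVB (s t : tensor2 R n) :
  tensor2_in_TV (s - t) = tensor2_in_TV s - tensor2_in_TV t.
Proof.
rewrite /tensor2_in_TV -sumrB; apply: eq_bigr => a _; rewrite -sumrB.
by apply: eq_bigr => b _; rewrite !mxE scalerBl.
Qed.

Lemma TV_to_poly_antisym (t : tensor2 R n) :
  (forall a b, t b a = - t a b) -> p (tensor2_in_TV t) = 0.
Proof.
move=> tN; have [_ pM] := TV_to_poly_mul.
have E : p (tensor2_in_TV t)
    = \sum_a \sum_b t a b *: (p (gen a) * p (gen b)).
  rewrite TV_to_poly_sum; apply: eq_bigr => a _; rewrite TV_to_poly_sum.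
  by apply: eq_bigr => b _; rewrite TV_to_polyZ pM.
have EN : p (tensor2_in_TV t) = - p (tensor2_in_TV t).
  rewrite {1}E exchange_big /= E -sumrN; apply: eq_bigr => a _.
  rewrite -sumrN; apply: eq_bigr => b _.
  by rewrite tN scaleNr mulrC.
move/eqP: EN; rewrite -subr_eq0 opprK -mulr2n -scaler_nat scaler_eq0.
by rewrite pnatr_eq0 /= => /eqP.
Qed.

Lemma TV_to_poly_ker_ideal : two_sided_ideal [set a | p a = 0].
Proof.
have [_ pM] := TV_to_poly_mul; split=> [|a b /= a0 b0|a b c /= b0].
- exact: TV_to_poly0.
- by rewrite TV_to_polyD a0 b0 addr0.
- by rewrite !pM b0 mulr0 mul0r.
Qed.

End PolynomialRing.

Unset Implicit Arguments.

Theorem proposition5p5 (R : realType) (eta : R[i])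
    (eta_upper : 0 < complex.Im eta) (n : nat) (n_gt1 : (1 < n)%N)
    (tau : R[i]) :
  is_quotient_by (Q_ideal n (n - 1) eta tau) (TV_to_poly R n_gt1).
Proof.
split.
- exact: TV_to_poly_linear.
- exact: TV_to_poly_mul.
- exact: TV_to_poly_surj.
move=> a; split=> [pa0 J J_ideal relJ|].
  apply: (ideal_ker J_ideal) pa0 => i j; apply: relJ.
  exists (wedge R i j); last by rewrite tensor2_in_TVB !tensor2_in_TV_delta.
  apply/(rel_nkE tau eta_upper n_gt1) => c d.
  rewrite !mxE opprB; congr (_%:R - _%:R); by rewrite andbC.
move=> Qa; have kerQ := Qa _ (TV_to_poly_ker_ideal R n_gt1).
apply: kerQ.
move=> _ [t /= tS <-]; apply: TV_to_poly_antisym.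
exact/(rel_nkE tau eta_upper n_gt1).
Qed.
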